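(* Let $n,k,t$ be integers with $2\le t<k$ and $n>2k-t$. Then the full $t$-star $\mathcal A_0$ is spectrally extremal among the $t$-intersecting subfamilies of $\binom{[n]}{k}$ if and only if $\rho_0\ge\rho_1$. If $\rho_0>\rho_1$, then $\mathcal A_0$ is, up to permutation, the unique spectrally extremal family among the $t$-intersecting subfamilies of $\binom{[n]}{k}$. If $\rho_0=\rho_1$, then both $\mathcal A_0$ and $\mathcal A_1$ are spectrally extremal (so the full $t$-star is not the unique extremal family).
   Context: Notation: $[n]=\{1,\dots,n\}$, and $\binom{X}{k}$ is the collection of $k$-element subsets of $X$. A family $\mathcal F\subseteq\binom{[n]}{k}$ is $t$-intersecting if $|F\cap F'|\ge t$ for all $F,F'\in\mathcal F$. For $\mathcal F\subseteq\binom{[n]}{k}$ and $x\in\mathbb R_{\ge0}^n$ put $P_{\mathcal F}(x)=k\sum_{F\in\mathcal F}\prod_{i\in F}x_i$ and $\rho(\mathcal F)=\max\{P_{\mathcal F}(x):x\ge0,\ \sum_i x_i^k=1\}$ (the spectral radius). A $t$-intersecting family is spectrally extremal if its $\rho$ is largest among all $t$-intersecting subfamilies of $\binom{[n]}{k}$. For $0\le r\le k-t$ the Frankl family is $\mathcal A_r=\{F\in\binom{[n]}{k}:|F\cap[t+2r]|\ge t+r\}$, and $\rho_r=\rho(\mathcal A_r)$. The full $t$-star is $\mathcal A_0=\{F\in\binom{[n]}{k}:[t]\subseteq F\}$ (or any image of it under a permutation of $[n]$). ''Up to permutation'' means up to applying a permutation of the ground set $[n]$. *)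

(* Defs.v *)
From mathcomp Require Import all_boot all_order all_algebra all_fingroup.
From mathcomp Require Import all_classical all_reals all_analysis.

Set Implicit Arguments.
Unset Strict Implicit.
Unset Printing Implicit Defensive.

Import Order.TTheory GRing.Theory Num.Theory.
Import numFieldNormedType.Exports.

Local Open Scope ring_scope.

(* The ground set [n] = {1, ..., n} is rendered as 'I_n = {0, ..., n - 1}, so
   that the initial segment [m] becomes the set of the i : 'I_n with i < m. *)

Definition uniform (n k : nat) (F : {set {set 'I_n}}) : bool :=
  [forall A in F, #|A| == k].

Definition t_intersecting (n t : nat) (F : {set {set 'I_n}}) : bool :=
  [forall A in F, forall B in F, (t <= #|A :&: B|)%N].

Definition segment (n m : nat) : {set 'I_n} := [set i : 'I_n | (i < m)%N]%SET.

Definition frankl (n k t r : nat) : {set {set 'I_n}} :=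
  [set A : {set 'I_n} |
     (#|A| == k) && (t + r <= #|A :&: segment n (t + 2 * r)|)%N]%SET.

Definition perm_family (n : nat) (s : {perm 'I_n}) (F : {set {set 'I_n}}) :
    {set {set 'I_n}} :=
  [set (s @: A)%SET | A : {set 'I_n} in F]%SET.

Definition equal_up_to_perm (n : nat) (F G : {set {set 'I_n}}) : Prop :=
  exists s : {perm 'I_n}, F = perm_family s G.

Definition family_form (R : realType) (n k : nat) (F : {set {set 'I_n}})
    (x : 'rV[R]_n) : R :=
  k%:R * \sum_(A in F) \prod_(i in A) x 0 i.

Definition nonneg_sphere (R : realType) (n k : nat) : set 'rV[R]_n :=
  [set x | (forall i, 0 <= x 0 i) /\ \sum_i x 0 i ^+ k = 1]%classic.
Arguments nonneg_sphere : clear implicits.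

(* For 0 < n and 0 < k this supremum is a maximum: see spectral_radius_max. *)
Definition spectral_radius (R : realType) (n k : nat) (F : {set {set 'I_n}}) :
    R :=
  sup [set family_form k F x | x in nonneg_sphere R n k]%classic.

Definition spectrally_extremal (R : realType) (n k t : nat)
    (F : {set {set 'I_n}}) : Prop :=
  [/\ uniform k F, t_intersecting t F &
      forall G : {set {set 'I_n}}, uniform k G -> t_intersecting t G ->
        spectral_radius R k G <= spectral_radius R k F].

Lemma continuous_family_form (R : realType) (n k : nat) (F : {set {set 'I_n}}) :
  continuous (family_form k F : 'rV[R]_n -> R).
Proof.
have cS : continuous (fun x : 'rV[R]_n => \sum_(A in F) \prod_(i in A) x 0 i).
  apply: continuous_big => [|A _]; first by apply: add_continuous.
  apply: continuous_big => [|i _]; first by apply: mul_continuous.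
  exact: coord_continuous.
move=> x; apply: (@continuous_comp _ _ _ _ (fun y : R => k%:R * y)).
  exact: cS.
exact: mulrl_continuous.
Qed.

Lemma compact_nonneg_sphere (R : realType) (n k : nat) :
  (0 < k)%N -> compact (nonneg_sphere R n k).
Proof.
move=> k0; apply: bounded_closed_compact.
  exists 1; split; first exact: num_real.
  move=> M M1 x [x0 x1]; apply: le_trans (ltW M1).
  rewrite /Num.norm/= mx_normrE; apply/bigmax_leP; split => //= -[i j] _ /=.
  rewrite (ord1 i) ger0_norm//.
  rewrite -(@ler_pXn2r _ k)// ?nnegrE// expr1n -x1 (bigD1 j)//= lerDl.
  by apply: sumr_ge0 => l _; exact: exprn_ge0.
have -> : nonneg_sphere R n k =
  ((\bigcap_i [set x : 'rV[R]_n | 0 <= x 0 i]) `&`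
   [set x : 'rV[R]_n | \sum_i x 0 i ^+ k = 1])%classic.
  apply/seteqP; split => x [h1 h2]; split=> // i; last exact: h1.
  by move=> _; exact: h1.
apply: closedI.
  apply: closed_bigI => i _.
  apply: (@preimage_closed _ _ (fun x : 'rV[R]_n => x 0 i)
    [set y : R | 0 <= y]%classic); last
    by apply: closed_ge.
  by move=> x _; exact: coord_continuous.
apply: (@preimage_closed _ _ (fun x : 'rV[R]_n => \sum_i x 0 i ^+ k)
    [set y : R | y = 1]%classic); last
    exact: closed_eq.
move=> x _; move: x; apply: continuous_big => [|i _ x].
  by apply: add_continuous.
apply: (@continuous_comp _ _ _ (fun x : 'rV[R]_n => x 0 i)
  (fun y : R => y ^+ k)); first exact: coord_continuous.
exact: exprn_continuous.
Qed.

Lemma nonneg_sphere_nonempty (R : realType) (n k : nat) :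
  (0 < n)%N -> (0 < k)%N -> (nonneg_sphere R n k !=set0)%classic.
Proof.
case: n => // n _ k0; exists (delta_mx 0 0); split.
  by move=> i; rewrite mxE ler0n.
rewrite (bigD1 0)//= big1 ?addr0 => [|i i0]; first by rewrite mxE !eqxx expr1n.
by rewrite mxE (negbTE i0) andbF expr0n gtn_eqF.
Qed.

Lemma spectral_radius_max (R : realType) (n k : nat) (F : {set {set 'I_n}}) :
  (0 < n)%N -> (0 < k)%N ->
  (exists2 x : 'rV[R]_n, nonneg_sphere R n k x &
     family_form k F x = spectral_radius R k F) /\
  (forall x : 'rV[R]_n, nonneg_sphere R n k x ->
     family_form k F x <= spectral_radius R k F).
Proof.
move=> n0 k0.
have ne := nonneg_sphere_nonempty R n0 k0.
have [|c cS cmax] := EVT_max_rV ne (@compact_nonneg_sphere R n k k0)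
    (f := family_form k F).
  exact/continuous_subspaceT/continuous_family_form.
rewrite inE in cS.
have ub x : nonneg_sphere R n k x -> family_form k F x <= family_form k F c.
  by move=> xS; apply: cmax; rewrite inE.
have -> : spectral_radius R k F = family_form k F c.
  apply/eqP; rewrite eq_le; apply/andP; split.
    apply: ge_sup; first by exists (family_form k F c), c.
    by move=> _ [x xS <-]; exact: ub.
  apply: ub_le_sup; last by exists c.
  by exists (family_form k F c) => _ [x xS <-]; exact: ub.
by split => //; exists c.
Qed.

(* Main.v *)
(* By compactness some pair of a family F and a vector x is globally optimal, and by
   relabelling and compression F may be taken shifted and x decreasing. For n > 2k - t
   the traces of F on [2k - t] t-intersect, so F is generated by a shifted t-intersecting
   up-set of subsets of [m] with m = 2k - t. As long as m > t + 2, the generating sets in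
   which m is indispensable are pushed or pulled as in Ahlswede and Khachatrian, while x is
   made constant on the elements m, ..., n. Flattening x costs nothing for the sets that do
   not depend on m, by AM-GM, and AM-GM also bounds the gain of the others by
   ((k - a) / (n - m + 1)) ^ (1 - 1/k), where a + 1 is the size of the generating set.
   When rho_0 >= rho_1, comparing A_0 with A_1 at the maximizer of A_0 shows that n is
   large enough for these gains to be too small, so m can be decreased. At m = t + 2 a
   family is contained in A_0 or in A_1. Uniqueness follows since the maximizer of A_0 is
   unique, positive and larger on [t], so that no compression can have led to A_0. *)
Require Import Defs.
From Stdlib Require Import ZArith.
From mathcomp Require Import all_boot all_order all_algebra all_fingroup.
From mathcomp Require Import all_classical all_reals all_analysis.
From mathcomp Require Import fintype finset zify ring lra.

Set Implicit Arguments.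
Unset Strict Implicit.
Unset Printing Implicit Defensive.

Import Order.TTheory GRing.Theory Num.Theory.

Local Open Scope ring_scope.

(** * Weighted arithmetic and geometric means *)

(** The obstacle is that the optimal vector is unknown. For the uniform measure the elements from
    the last generating element [e] on are interchangeable, and the share of the sets containing [e]
    among those with a given trace can be computed; here [x] may concentrate its mass on [e].
    Flattening restores the symmetry for the competitors only: [U] is still weighed at [x], so the
    share is bounded by its largest value over all tails with the same power sum. This turns the
    exponent 1 of the uniform share into 1 - 1/k. Sets in which [e] is indispensable conflict only
    if their sizes, without [e], add up to a fixed number. Averaging over which of two such sizes is
    kept needs fractions with sum 1: 3/5 for the smaller size, which leaves more elements to choose
    in the tail and so has the larger share, and 2/5 for the other. For equal sizes one keeps the
    sets that avoid a chosen point. Maximality of [x] makes the estimates equalities, so it shows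
    only that discarded sets have weight zero at [x]. As coordinates of [x] may vanish, families can
    be compared only on sets of nonzero weight. *)

Definition weight (R : realType) (T : finType) (x : T -> R) (A : {set T}) : R :=
  \prod_(i in A) x i.

Lemma weight_ge0 (R : realType) (T : finType) (x : T -> R) (A : {set T}) :
  (forall i, 0 <= x i) -> 0 <= weight x A.
Proof. by move=> x0; apply: prodr_ge0. Qed.

Lemma weightU1 (R : realType) (T : finType) (x : T -> R) (i : T) (A : {set T}) :
  i \notin A -> weight x (i |: A) = x i * weight x A.
Proof. by move=> iA; rewrite /weight big_setU1. Qed.

Lemma weightU (R : realType) (T : finType) (x : T -> R) (A B : {set T}) :
  [disjoint A & B] -> weight x (A :|: B) = weight x A * weight x B.
Proof.
by move=> dAB; rewrite /weight -bigU //=; apply: eq_bigl => i; rewrite inE.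
Qed.

Lemma eq_weight (R : realType) (T : finType) (x y : T -> R) (A : {set T}) :
  {in A, x =1 y} -> weight x A = weight y A.
Proof. by move=> xy; apply: eq_bigr. Qed.

(* [#|A|] of the [k] factors are the [z i], the others are [1]. *)
Lemma prod_le_mean_pow (R : realType) (T : finType) (z : T -> R) (A : {set T})
    (k : nat) :
  (forall i, 0 <= z i) -> (0 < k)%N -> (#|A| <= k)%N ->
  weight z A <= (\sum_(i in A) z i ^+ k + (k - #|A|)%:R) / k%:R.
Proof.
move=> z0 k0 Ak.
pose p (u : T + 'I_(k - #|A|)) := if u is inl i then i \in A else true.
pose E (u : T + 'I_(k - #|A|)) : R := if u is inl i then z i ^+ k else 1.
have sE (F : T + 'I_(k - #|A|) -> R) :
    \sum_(u | p u) F u = \sum_(i in A) F (inl i) + \sum_j F (inr j).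
  by rewrite big_sumType.
have cp : #|p| = k.
  apply/eqP; rewrite -(eqr_nat R) -sumr_const sE !sumr_const card_ord.
  by rewrite -natrD subnKC // eqxx.
have E0 : {in p, forall u, 0 <= E u}.
  by move=> [i|j] _ /=; rewrite ?exprn_ge0.
have := (leif_AGM E0).1; rewrite cp sE.
have -> : \prod_(u in p) E u = weight z A ^+ k.
  have -> : \prod_(u in p) E u = \prod_(u | p u) E u by [].
  by rewrite big_sumType /= [X in _ * X]big1 // mulr1 prodrXl.
rewrite /E sumr_const card_ord ler_pXn2r ?nnegrE // ?weight_ge0 //.
by rewrite divr_ge0 // addr_ge0 // sumr_ge0 // => i _; rewrite exprn_ge0.
Qed.

(* Weighted AM-GM, with equality at [z = v]: applied to a vector [v] satisfying the
   Lagrange equations, it certifies that [v] is a global maximizer. *)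
Lemma sum_weight_le_deg (R : realType) (T : finType) (D : {set {set T}})
    (v z : T -> R) (k l : nat) :
  (0 < k)%N -> (l <= k)%N -> (forall A, A \in D -> #|A| = l) ->
  (forall i, 0 < v i) -> (forall i, 0 <= z i) ->
  k%:R * \sum_(A in D) weight z A <=
  \sum_i (\sum_(A in D | i \in A) weight v A) * (z i / v i) ^+ k +
  (k - l)%:R * \sum_(A in D) weight v A.
Proof.
move=> k0 lk cD v0 z0.
have kR0 : (0 : R) < k%:R by rewrite ltr0n.
have zv0 i : 0 <= z i / v i by rewrite divr_ge0 // ltW.
have wzE A : weight z A = weight v A * weight (fun i => z i / v i) A.
  rewrite /weight -big_split /=; apply: eq_bigr => i _.
  by rewrite mulrC divfK // gt_eqF.
rewrite mulr_sumr.
apply: (@le_trans _ _ (\sum_(A in D) weight v A *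
   (\sum_(i in A) (z i / v i) ^+ k + (k - l)%:R))).
  apply: ler_sum => A AD; rewrite wzE mulrCA ler_wpM2l //.
    by apply: weight_ge0 => i; exact: ltW.
  rewrite mulrC -ler_pdivlMr // -(cD _ AD).
  by apply: prod_le_mean_pow => //; rewrite cD.
under eq_bigr do rewrite mulrDr.
rewrite big_split /= -mulr_suml [_ * (k - l)%:R]mulrC lerD2r.
rewrite (eq_bigr (fun A : {set T} => \sum_(i | i \in A) weight v A * (z i / v i) ^+ k));
    last first.
  by move=> A _; rewrite mulr_sumr.
rewrite (exchange_big_dep xpredT) //=.
by apply: ler_sum => i _; rewrite mulr_suml.
Qed.

(** * Elementary symmetric sums against the power mean *)

Definition esum (R : realType) (T : finType) (x : T -> R) (Z : {set T}) (l : nat) : R :=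
  \sum_(D : {set T} | (D \subset Z) && (#|D| == l)) weight x D.

Lemma esum0 (R : realType) (T : finType) (x : T -> R) (Z : {set T}) :
  esum x Z 0 = 1.
Proof.
rewrite /esum (big_pred1 set0) => [|D]; first by rewrite /weight big_set0.
by rewrite /= cards_eq0 andbC; case: eqP => [->|//]; rewrite sub0set.
Qed.

Lemma esum_const (R : realType) (T : finType) (x : T -> R) (b : R) (Z : {set T})
    (l : nat) :
  {in Z, x =1 fun=> b} -> esum x Z l = 'C(#|Z|, l)%:R * b ^+ l.
Proof.
move=> xb; rewrite /esum (eq_bigr (fun=> b ^+ l)).
  rewrite sumr_const -[LHS]mulr_natl -cards_draws; congr (_%:R * _).
  by apply: eq_card => D; rewrite !inE.
move=> D /andP[/subsetP DZ /eqP <-].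
by rewrite (eq_weight (y := fun=> b)) ?/weight ?prodr_const // => i /DZ /xb.
Qed.

Lemma sum_draws_mem (V : nmodType) (T : finType) (Z : {set T}) (e : T) (l : nat)
    (F : {set T} -> V) :
  e \in Z ->
  \sum_(D : {set T} | [&& D \subset Z, #|D| == l.+1 & e \in D]) F D =
  \sum_(D : {set T} | (D \subset Z :\ e) && (#|D| == l)) F (e |: D)%SET.
Proof.
move=> eZ; rewrite (reindex_onto (fun D => e |: D)%SET (fun D => D :\ e)%SET) /=.
  apply: eq_bigl => D; rewrite subUset sub1set eZ /= setU11 andbT subsetD1.
  case eD: (e \in D).
    rewrite andbF /=; apply/negbTE/negP => /andP[_ /eqP h].
    by move: eD; rewrite -h !inE eqxx.
  by rewrite cardsU1 eD add1n eqSS setU1K ?eD // eqxx andbT andbT.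
by move=> D /and3P[_ _ eD]; rewrite setD1K.
Qed.

Lemma esum_mem (R : realType) (T : finType) (x : T -> R) (Z : {set T}) (e : T)
    (l : nat) :
  e \in Z ->
  \sum_(D : {set T} | [&& D \subset Z, #|D| == l.+1 & e \in D]) weight x D =
  x e * esum x (Z :\ e) l.
Proof.
move=> eZ; rewrite sum_draws_mem // /esum mulr_sumr; apply: eq_bigr => D.
by rewrite subsetD1 => /andP[/andP[_ eD] _]; rewrite weightU1.
Qed.

(** A form of Maclaurin's inequality, with the power mean of exponent [k] on the right. The
    certificate [sum_weight_le_deg] is evaluated at the constant vector [b], where all elements of
    [Z] have the same degree. *)
Lemma esum_le_flat (R : realType) (T : finType) (x : T -> R) (Z : {set T})
    (b : R) (k l : nat) :
  (0 < k)%N -> (l <= k)%N -> (forall i, 0 <= x i) -> 0 <= b ->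
  \sum_(i in Z) x i ^+ k = #|Z|%:R * b ^+ k ->
  esum x Z l <= 'C(#|Z|, l)%:R * b ^+ l.
Proof.
(* The certificate needs a positive vector; if [b = 0], then [x] vanishes on [Z]. *)
move=> k0 lk x0; rewrite le_eqVlt => /predU1P[<-|b0].
  rewrite expr0n (gtn_eqF k0) mulr0 => sx.
  have xZ : {in Z, x =1 fun=> 0}.
    move=> i iZ; have /eqP := psumr_eq0P (fun j _ => exprn_ge0 k (x0 j)) sx iZ.
    by rewrite expf_eq0 k0 => /eqP.
  by rewrite (esum_const l (b := 0)).
case: l lk => [|l] lk; first by rewrite esum0 bin0 mulr1.
case: (posnP #|Z|) => [/eqP|].
  rewrite cards_eq0 => /eqP Z0 _; rewrite Z0 cards0 bin0n /= mul0r.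
  rewrite /esum big1 // => D /andP[]; rewrite subset0 => /eqP ->.
  by rewrite cards0.
move=> Z0 sx.
have kR0 : (0 : R) < k%:R by rewrite ltr0n.
have := @sum_weight_le_deg R T [set D : {set T} | (D \subset Z) && (#|D| == l.+1)]%SET
  (fun=> b) x k l.+1 k0 lk _ (fun=> b0) x0.
have wb : forall D : {set T}, #|D| == l.+1 -> weight (fun=> b) D = b ^+ l.+1.
  by move=> D /eqP <-; rewrite /weight prodr_const.
have dE P : (\sum_(D in [set D : {set T} | (D \subset Z) && (#|D| == l.+1)]%SET | P D)
    weight (fun=> b) D : R) =
    \sum_(D : {set T} | [&& D \subset Z, #|D| == l.+1 & P D]) b ^+ l.+1.
  rewrite (eq_bigl (fun D : {set T} => [&& D \subset Z, #|D| == l.+1 & P D])).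
    by apply: eq_bigr => D /and3P[_ + _]; apply: wb.
  by move=> D; rewrite inE andbA.
have sE y : (\sum_(D in [set D : {set T} | (D \subset Z) && (#|D| == l.+1)]%SET) weight y D
    : R) =
    esum y Z l.+1 by apply: eq_bigl => D; rewrite inE.
rewrite !sE (@esum_const _ _ (fun=> b) b) //.
have -> : \sum_i (\sum_(A in [set D : {set T} | (D \subset Z) && (#|D| == l.+1)]%SET | i
    \in A) weight (fun=> b) A) * (x i / b) ^+ k =
   l.+1%:R * ('C(#|Z|, l.+1)%:R * b ^+ l.+1).
  rewrite (bigID (mem Z)) /= [X in _ + X]big1 ?addr0; last first.
    move=> i iZ; rewrite dE big1 ?mul0r // => D /and3P[/subsetP DZ _ /DZ].
    by rewrite (negbTE iZ).
  transitivity (\sum_(i in Z) ('C(#|Z|.-1, l)%:R * b ^+ l.+1) * (x i / b) ^+ k).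
    apply: eq_bigr => i iZ; congr (_ * _); rewrite dE.
    rewrite (sum_draws_mem l (fun=> b ^+ l.+1) iZ) sumr_const -[LHS]mulr_natl.
    congr (_%:R * _); rewrite [#|Z|](cardsD1 i) iZ -cards_draws.
    by apply: eq_card => D; rewrite !inE.
  rewrite -mulr_sumr; under eq_bigr do rewrite expr_div_n.
  rewrite -mulr_suml sx mulfK ?gt_eqF ?exprn_gt0 // mulrAC mulrA -!natrM.
  by rewrite [X in X%:R]mulnC mul_bin_diag.
move=> h; rewrite -(ler_pM2l kR0); apply: le_trans (h _) _.
  by move=> A; rewrite inE => /andP[_ /eqP].
by rewrite -mulrDl -natrD subnKC.
Qed.

(* The maximum in the first factor is at [x e ^+ k = (#|Z| / l.+1) b ^+ k]: [eta] and
   [zeta] are the ratios to [b] of [x e] and of the other entries at the point where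
   the certificate is evaluated; [zeta = 1] is allowed but not optimal. *)
Lemma esum_mem_le_root (R : realType) (T : finType) (x : T -> R) (Z : {set T})
    (e : T) (b eta zeta : R) (k l : nat) :
  (l < k)%N -> e \in Z -> (forall i, 0 <= x i) -> 0 <= b ->
  \sum_(i in Z) x i ^+ k = #|Z|%:R * b ^+ k ->
  0 < eta -> 0 < zeta -> eta ^+ k * l.+1%:R = #|Z|%:R ->
  (l * #|Z|)%:R <= zeta ^+ k * (l.+1 * #|Z|.-1)%:R ->
  x e * esum x (Z :\ e) l <= eta * zeta ^+ l * ('C(#|Z|.-1, l)%:R * b ^+ l.+1).
Proof.
move=> lk eZ x0 + + eta0 zeta0 etaE zetaE.
have k0 : (0 < k)%N by case: k lk {etaE zetaE}.
rewrite le_eqVlt => /predU1P[<-|b0].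
  rewrite expr0n (gtn_eqF k0) mulr0 => sx.
  have /eqP := psumr_eq0P (fun j _ => exprn_ge0 k (x0 j)) sx eZ.
  by rewrite expf_eq0 k0 => /eqP ->; rewrite mul0r expr0n /= !mulr0.
move=> sx; have Z0 : (0 < #|Z|)%N by apply/card_gt0P; exists e.
have kR0 : (0 : R) < k%:R by rewrite ltr0n.
have ZR0 : (0 : R) < #|Z|%:R by rewrite ltr0n.
pose Ds := [set D : {set T} | [&& D \subset Z, #|D| == l.+1 & e \in D]]%SET.
pose v i := if i == e then eta * b else zeta * b.
have v0 i : 0 < v i by rewrite /v; case: ifP; rewrite mulr_gt0.
pose om := eta * zeta ^+ l * b ^+ l.+1.
have om0 : 0 < om by rewrite !mulr_gt0 ?exprn_gt0.
have wv D : D \in Ds -> weight v D = om.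
  rewrite inE => /and3P[_ /eqP cD eD]; rewrite -(setD1K eD) weightU1 ?setD11 //.
  have -> : weight v (D :\ e) = (zeta * b) ^+ l.
    rewrite (eq_weight (y := fun=> zeta * b)) => [|i]; last first.
      by rewrite !inE /v => /andP[/negbTE ->].
    by move: cD; rewrite (cardsD1 e) eD => -[<-]; rewrite /weight prodr_const.
  by rewrite /v eqxx /om exprMn exprS; ring.
have cDs : #|Ds| = 'C(#|Z|.-1, l).
  rewrite -sum1_card (eq_bigl (fun D : {set T} => [&& D \subset Z, #|D| == l.+1 & e \in D])).
    rewrite (sum_draws_mem l (fun=> 1%N) eZ) sum1_card [#|Z|](cardsD1 e) eZ.
    by rewrite -cards_draws; apply: eq_card => D; rewrite !inE.
  by move=> D; rewrite inE.
have degE P : \sum_(D in Ds | P D) weight v D = #|[set D in Ds | P D]%SET|%:R * om.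
  rewrite (eq_bigr (fun=> om)) => [|D /andP[/wv -> //]].
  by rewrite sumr_const -[LHS]mulr_natl; congr (_%:R * _); apply: eq_card => D; rewrite inE.
pose c : R := 'C(#|Z|.-1, l)%:R.
have c0 : 0 <= c by rewrite ler0n.
have deg_e : #|[set D in Ds | e \in D]%SET| = 'C(#|Z|.-1, l).
  rewrite -cDs; apply: eq_card => D; rewrite !inE.
  by case: (e \in D); rewrite ?andbT ?andbF.
(* Double counting, kept in product form so that no division by [#|Z|.-1] occurs. *)
have deg_i i : i \in Z :\ e ->
    (#|[set D in Ds | i \in D]%SET| * #|Z|.-1 = l * 'C(#|Z|.-1, l))%N.
  move=> iZ; have -> : #|[set D in Ds | i \in D]%SET| =
      (\sum_(D : {set T} | [&& D \subset Z, #|D| == l.+1 & e \in D]) (i \in D))%N.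
    rewrite -sum1_card big_mkcond [RHS]big_mkcond; apply: eq_bigr => D _.
    by rewrite !inE; case: (i \in D); rewrite ?andbT ?andbF //; case: ifP.
  rewrite (sum_draws_mem l (fun D => (i \in D) : nat) eZ).
  have -> : #|Z|.-1 = #|Z :\ e| by rewrite [#|Z|](cardsD1 e) eZ.
  have ie : i != e by move: iZ; rewrite !inE => /andP[].
  case: l {lk etaE zetaE om om0 wv Ds cDs degE c c0 deg_e} => [|l].
    rewrite big1 // => D; rewrite subsetD1 cards_eq0 => /andP[/andP[_ _] /eqP ->].
    by rewrite !inE (negbTE ie).
  rewrite (eq_bigr (fun D : {set T} => if i \in D then 1 else 0)%N); last first.
    by move=> D _; rewrite !inE (negbTE ie) /=; case: (i \in D).
  rewrite -big_mkcondr /= (eq_bigl (fun D : {set T} =>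
      [&& D \subset Z :\ e, #|D| == l.+1 & i \in D])); last first.
    by move=> D; rewrite andbA.
  rewrite (sum_draws_mem l (fun=> 1%N) iZ) sum1_card.
  rewrite mulnC -mul_bin_diag; congr (_ * _)%N.
  rewrite [#|Z :\ e|](cardsD1 i) iZ -cards_draws.
  by apply: eq_card => D; rewrite !inE.
have := @sum_weight_le_deg R T Ds v x k l.+1 k0 lk _ v0 x0.
have -> : \sum_(A in Ds) weight x A = x e * esum x (Z :\ e) l.
  by rewrite -esum_mem //; apply: eq_bigl => D; rewrite inE.
have -> : \sum_(A in Ds) weight v A = c * om.
  rewrite (eq_bigr (fun=> om)) => [|D /wv -> //].
  by rewrite sumr_const cDs -[LHS]mulr_natl.
move=> h; rewrite -(ler_pM2l kR0); apply: le_trans (h _) _.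
  by move=> A; rewrite inE => /and3P[_ /eqP].
rewrite (_ : k%:R * _ = l.+1%:R * (c * om) + (k - l.+1)%:R * (c * om)); last first.
  by rewrite -mulrDl -natrD subnKC // /om /c; ring.
rewrite lerD2r.
apply: (@le_trans _ _ (\sum_(i in Z) (c * om) * (l.+1%:R / #|Z|%:R) * (x i / b) ^+ k)).
  rewrite (bigID (mem Z)) /= [X in _ + X]big1 ?addr0; last first.
    move=> i iZ; rewrite big1 ?mul0r // => D; rewrite inE.
    by case/andP=> /and3P[/subsetP DZ _ _] /DZ; rewrite (negbTE iZ).
  apply: ler_sum => i iZ; rewrite degE /v; case: (eqVneq i e) => [->|ie].
    rewrite deg_e -/c !expr_div_n exprMn.
    rewrite le_eqVlt; apply/orP; left; apply/eqP.
    have bk : b ^+ k != 0 by rewrite expf_neq0 // gt_eqF.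
    have ek : eta ^+ k != 0 by rewrite expf_neq0 // gt_eqF.
    have lR0 : l.+1%:R != 0 :> R by rewrite pnatr_eq0.
    rewrite -etaE; move: (l.+1%:R : R) lR0 => lR lR0.
    by field; rewrite lR0 ek bk.
  have {}iZ : i \in Z :\ e by rewrite !inE ie.
  have Z1 : (0 < #|Z|.-1)%N.
    by rewrite [#|Z|](cardsD1 e) eZ; apply/card_gt0P; exists i.
  have Z1R : (0 : R) < #|Z|.-1%:R by rewrite ltr0n.
  move: (deg_i i iZ) => /(congr1 (fun j => j%:R : R)); rewrite !natrM -/c => dE.
  have y0 : 0 <= (x i / b) ^+ k by rewrite exprn_ge0 // divr_ge0 // ltW.
  have -> : (x i / (zeta * b)) ^+ k = (x i / b) ^+ k / zeta ^+ k.
    by rewrite -expr_div_n; congr (_ ^+ _); field; rewrite !gt_eqF.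
  rewrite [X in _ <= X](_ : _ = (om * (x i / b) ^+ k) * (c * (l.+1%:R / #|Z|%:R))); last first.
    by move: (l.+1%:R / _) ((x i / b) ^+ k) => u y; ring.
  rewrite [X in X <= _](_ : _ = (om * (x i / b) ^+ k) * (#|[set D in Ds | i \in D]%SET|%:R
      / zeta ^+ k)); last first.
    by rewrite mulrA [RHS]mulrA; congr (_ / _); ring.
  apply: ler_wpM2l; first by rewrite mulr_ge0 // ltW.
  rewrite ler_pdivrMr ?exprn_gt0 // -(ler_pM2r Z1R) dE.
  rewrite -(ler_pM2r ZR0).
  rewrite [X in _ <= X](_ : _ = c * (zeta ^+ k * (l.+1%:R * #|Z|.-1%:R))); last first.
    by field; rewrite gt_eqF.
  rewrite [X in X <= _](_ : _ = c * (l%:R * #|Z|%:R)); last by ring.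
  by rewrite ler_wpM2l // -!natrM.
rewrite -mulr_sumr; under eq_bigr do rewrite expr_div_n.
rewrite -mulr_suml sx mulfK ?gt_eqF ?exprn_gt0 //.
by rewrite -[X in X <= _]mulrA divfK ?gt_eqF // mulrC.
Qed.

(* An integer form of [lambda ^ (k - 1) * zeta ^ (k * (l - 1)) < (p / q) ^ k] with
   [lambda = l / M] and [zeta = g / h]. *)
Definition contracts (k l M p q : nat) : Prop :=
  exists g h : nat, [/\ (0 < g)%N, (0 < h)%N,
    (l.-1 * M * h ^ k <= g ^ k * (l * M.-1))%N &
    (q ^ k * l ^ k.-1 * g ^ (k * l.-1) < p ^ k * M ^ k.-1 * h ^ (k * l.-1))%N].

(** The identity [#|Z| * 'C(#|Z|.-1, l) = l.+1 * 'C(#|Z|, l.+1)] turns the previous bound into a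
    multiple [kap] of the flat value, and [contracts] says that [kap < p / q]. Both sides may
    vanish, so strictness takes the form of the second clause. *)
Lemma esum_mem_lt (R : realType) (T : finType) (x : T -> R) (Z : {set T})
    (e : T) (b : R) (k l p q : nat) :
  (0 < q)%N -> (l < k)%N -> e \in Z -> (forall i, 0 <= x i) -> 0 <= b ->
  \sum_(i in Z) x i ^+ k = #|Z|%:R * b ^+ k ->
  contracts k l.+1 #|Z| p q ->
  let X := x e * esum x (Z :\ e) l in
  let Y := p%:R / q%:R * ('C(#|Z|, l.+1)%:R * b ^+ l.+1) in
  X <= Y /\ (X = Y -> X = 0).
Proof.
move=> q0 lk eZ x0 b0 sx [g [h [g0 h0 gh bnd]]] X Y.
have k0 : (0 < k)%N by case: k lk {gh bnd sx}.
have Z0 : (0 < #|Z|)%N by apply/card_gt0P; exists e.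
have ZR0 : (0 : R) < #|Z|%:R by rewrite ltr0n.
have lR0 : (0 : R) < l.+1%:R by rewrite ltr0n.
have qR0 : (0 : R) < q%:R by rewrite ltr0n.
have gR0 : (0 : R) < g%:R by rewrite ltr0n.
have hR0 : (0 : R) < h%:R by rewrite ltr0n.
pose eta : R := (#|Z|%:R / l.+1%:R) `^ k%:R^-1.
have eta0 : 0 < eta by rewrite powR_gt0 // divr_gt0.
have etaE : eta ^+ k = #|Z|%:R / l.+1%:R.
  rewrite -powR_mulrn ?ltW // -powRrM mulVf ?pnatr_eq0 -?lt0n //.
  by rewrite powRr1 // divr_ge0 // ltW.
pose zeta : R := g%:R / h%:R.
have zeta0 : 0 < zeta by rewrite divr_gt0.
pose E : R := 'C(#|Z|, l.+1)%:R * b ^+ l.+1.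
have E0 : 0 <= E by rewrite mulr_ge0 // exprn_ge0.
pose kap := eta * zeta ^+ l * (l.+1%:R / #|Z|%:R).
have kap0 : 0 <= kap by rewrite !mulr_ge0 ?invr_ge0 ?exprn_ge0 // ltW.
have XE : X <= kap * E.
  have := @esum_mem_le_root R T x Z e b eta zeta k l lk eZ x0 b0 sx eta0 zeta0.
  rewrite etaE divfK ?gt_eqF // => /(_ erefl); rewrite /zeta expr_div_n.
  rewrite mulrAC ler_pdivlMr ?exprn_gt0 // -!natrX -!natrM ler_nat => /(_ gh).
  move=> /le_trans; apply; rewrite le_eqVlt; apply/orP; left; apply/eqP.
  rewrite /kap /E -!mulrA; congr (_ * (_ * _)); rewrite !mulrA; congr (_ * _).
  have := mul_bin_diag #|Z| l => /(congr1 (fun j => j%:R : R)); rewrite !natrM => bE.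
  apply: (@mulfI _ #|Z|%:R); first by rewrite gt_eqF.
  by rewrite bE; field; rewrite gt_eqF.
have kap1 : kap < p%:R / q%:R.
  rewrite -(@ltr_pXn2r _ k) // ?nnegrE ?divr_ge0 //.
  have -> : kap ^+ k = (g%:R ^+ (k * l) * l.+1%:R ^+ k.-1) / (h%:R ^+ (k * l) * #|Z|%:R ^+
      k.-1).
    have LZ : (l.+1%:R / #|Z|%:R) ^+ k = l.+1%:R / #|Z|%:R * (l.+1%:R ^+ k.-1 / #|Z|%:R ^+
        k.-1) :> R.
      by rewrite -expr_div_n -exprS prednK.
    have zl : (zeta ^+ l) ^+ k = g%:R ^+ (k * l) / h%:R ^+ (k * l).
      by rewrite -exprM mulnC expr_div_n.
    rewrite /kap exprMn [(eta * _) ^+ k]exprMn etaE LZ zl -mulf_div.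
    move: (_ / h%:R ^+ _) (l.+1%:R ^+ _ / _) => u v.
    by field; rewrite !gt_eqF.
  rewrite expr_div_n ltr_pdivlMr ?exprn_gt0 // mulrAC ltr_pdivrMr; last first.
    by rewrite mulr_gt0 ?exprn_gt0.
  move: bnd; rewrite -(ltr_nat R) !natrM !natrX /= => bnd.
  by rewrite [X in X < _](_ : _ = q%:R ^+ k * l.+1%:R ^+ k.-1 * g%:R ^+ (k * l));
    [rewrite [X in _ < X](_ : _ = p%:R ^+ k * #|Z|%:R ^+ k.-1 * h%:R ^+ (k * l)) //; ring|ring].
split; first by apply: le_trans XE _; rewrite ler_wpM2r // ltW.
move=> XY; have : (p%:R / q%:R - kap) * E <= 0.
  by rewrite mulrBl subr_le0 -/E; move: XE; rewrite XY.
rewrite pmulr_rle0 ?subr_gt0 // => E1.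
have {E0 E1}E00 : E = 0 by apply/eqP; rewrite eq_le E0 E1.
by rewrite XY /Y -/E E00 mulr0.
Qed.

(** * Numerical bounds *)

(* For [k = t + d] and [n = t + L], this says that the full star is at least as heavy
   as [A_1] at the maximizer of the full star. *)
Definition star_beats (t d L : nat) : bool :=
  (t ^ (t + d) * d ^ (t + d).+1 <= (L - d.+1) ^ (t + d) * L)%N.

Lemma Z_of_nat_muln (a b : nat) : Z.of_nat (a * b)%N = Z.mul (Z.of_nat a) (Z.of_nat b).
Proof. exact: Nat2Z.inj_mul. Qed.

Lemma Z_of_nat_expn (a b : nat) : Z.of_nat (a ^ b) = Z.pow (Z.of_nat a) (Z.of_nat b).
Proof.
elim: b => [|b IHb]; first by rewrite expn0.
by rewrite expnS Nat2Z.inj_mul IHb Nat2Z.inj_succ Z.pow_succ_r //; lia.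
Qed.

Lemma leq_Z (a b : nat) : (a <= b)%N = Z.leb (Z.of_nat a) (Z.of_nat b).
Proof. by apply/idP/idP => h; lia. Qed.

Lemma ltn_Z (a b : nat) : (a < b)%N = Z.ltb (Z.of_nat a) (Z.of_nat b).
Proof. by apply/idP/idP => h; lia. Qed.

Lemma muln_of_Z (a b : nat) (u v : Z) :
  Z.of_nat a = u -> Z.of_nat b = v -> Z.of_nat (a * b)%N = Z.mul u v.
Proof. by move=> <- <-; exact: Z_of_nat_muln. Qed.

Lemma expn_of_Z (a b : nat) (u v : Z) :
  Z.of_nat a = u -> Z.of_nat b = v -> Z.of_nat (a ^ b)%N = Z.pow u v.
Proof. by move=> <- <-; exact: Z_of_nat_expn. Qed.

Lemma leq_of_Z (a b : nat) (u v : Z) :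
  Z.of_nat a = u -> Z.of_nat b = v -> Z.leb u v -> (a <= b)%N.
Proof. by move=> <- <-; rewrite leq_Z. Qed.

Lemma ltn_of_Z (a b : nat) (u v : Z) :
  Z.of_nat a = u -> Z.of_nat b = v -> Z.ltb u v -> (a < b)%N.
Proof. by move=> <- <-; rewrite ltn_Z. Qed.

(* Decides closed inequalities between products of powers in binary; rewriting
   with the lemmas above would unfold the unary powers during unification. *)
Ltac binary e :=
  lazymatch e with
  | muln ?a ?b => let p := binary a in let q := binary b in constr:(muln_of_Z p q)
  | expn ?a ?b => let p := binary a in let q := binary b in constr:(expn_of_Z p q)
  | _ => constr:(erefl (Z.of_nat e))
  end.

Ltac nat_vm :=
  lazymatch goal with
  | |- is_true (leq (S ?a) ?b) =>
    let p := binary a in let q := binary b in apply: (ltn_of_Z p q)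
  | |- is_true (leq ?a ?b) =>
    let p := binary a in let q := binary b in apply: (leq_of_Z p q)
  end; vm_compute; reflexivity.

Lemma leq_expn2r (m n e : nat) : (m <= n)%N -> (m ^ e <= n ^ e)%N.
Proof. by case: e => // e mn; rewrite leq_exp2r. Qed.

(** The conditions to be checked depend on [l] and [M] only through [l / M], and it suffices to
    check them at a larger ratio [A / B]. *)
Lemma leq_exp_ratio (l M A B j P Q : nat) :
  (l * B <= A * M)%N -> (0 < M)%N -> (Q * A ^ j < P * B ^ j)%N ->
  (Q * l ^ j < P * M ^ j)%N.
Proof.
move=> lB M0 QA; have Bj : (0 < B ^ j)%N.
  by case: (posnP (B ^ j)) QA => // ->; rewrite muln0.
rewrite -(ltn_pmul2r Bj) -mulnA -expnMn; apply: (@leq_ltn_trans (Q * (A * M) ^ j)).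
  by rewrite leq_mul2l leq_expn2r ?orbT.
by rewrite expnMn mulnA [X in (_ < X)%N]mulnAC ltn_pmul2r // expn_gt0 M0.
Qed.

Lemma expn_6_5 (k : nat) : (16 <= k)%N -> (k.-1 * 5 ^ k <= 6 ^ k)%N.
Proof.
move=> /subnK <-; elim: (k - 16)%N => [|j IHj]; first by nat_vm.
move: IHj; rewrite addSn !expnS; move: (5 ^ _)%N (6 ^ _)%N => u v; nia.
Qed.

(** For [t >= 2] the base [3 t / (2 t + 1)] is at least 6/5, and [(6 / 5) ^ k >= k - 1 >= t + 1]. *)
Lemma expn_star_ratio (t k : nat) : (2 <= t)%N -> (16 <= k)%N -> (t + 2 <= k)%N ->
  (t.+1 * (2 * t + 1) ^ k <= (3 * t) ^ k)%N.
Proof.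
move=> t2 k16 tk; rewrite -(@leq_pmul2r (5 ^ k)) ?expn_gt0 //.
apply: (@leq_trans ((5 ^ k * k.-1) * (2 * t + 1) ^ k)).
  have tk1 : (t.+1 <= k.-1)%N by lia.
  by move: (5 ^ k)%N ((2 * t + 1) ^ k)%N => u v; nia.
apply: (@leq_trans (6 ^ k * (2 * t + 1) ^ k)).
  by rewrite leq_mul2r [(5 ^ _ * _)%N]mulnC expn_6_5 ?orbT.
by rewrite -!expnMn leq_expn2r //; lia.
Qed.

(** For [t >= 7] the base [(4 t + 8) / (3 t + 9)] is at least 6/5; the smaller [t] start from
    [k = 16], which for [t = 2] is the first exponent that works. *)
Lemma expn_frankl2_ratio (t k : nat) : (2 <= t)%N -> (16 <= k)%N ->
  (t + 2 <= k)%N -> ((2 * t + 4) * (3 * t + 9) ^ k < 3 * (4 * t + 8) ^ k)%N.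
Proof.
move=> t2 k16 tk.
have base p q c : (0 < q)%N -> (q <= p)%N -> (c * q ^ 16 < 3 * p ^ 16)%N ->
    (c * q ^ k < 3 * p ^ k)%N.
  move=> q0 qp h; rewrite -(subnK k16); elim: (k - 16)%N => [|j IHj]; first by rewrite add0n.
  by rewrite addSn !expnS; move: IHj; move: (q ^ _)%N (p ^ _)%N => u v; nia.
case: (leqP t 6) => t6; last first.
  rewrite -(@ltn_pmul2r (5 ^ k)) ?expn_gt0 //.
  apply: (@leq_trans (3 * (3 * t + 9) ^ k * 6 ^ k)); last first.
    rewrite -!mulnA -!expnMn leq_mul2l /= leq_expn2r //; lia.
  apply: (@leq_trans (3 * (3 * t + 9) ^ k * (k.-1 * 5 ^ k))); last first.
    by rewrite leq_mul2l expn_6_5 ?orbT.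
  rewrite [X in (_ < X)%N](_ : _ = (3 * k.-1) * (3 * t + 9) ^ k * 5 ^ k)%N; last by ring.
  rewrite ltn_pmul2r ?expn_gt0 // ltn_pmul2r ?expn_gt0 //; last by rewrite addn_gt0 orbT.
  by lia.
by case: t t2 t6 tk => [|[|[|[|[|[|[|t]]]]]]] // _ _ _; (apply: base; [by []|by []|nat_vm]).
Qed.

(* In these two cases the next bound just fails, and [contracts_middle] needs
   [zeta < 1]. *)
Definition exceptional (t d L : nat) : bool :=
  ((t, d, L) == (2, 3, 9)%N) || ((t, d, L) == (2, 4, 12)%N).

Lemma star_beats_small (t d L : nat) :
  (2 <= t)%N -> (2 <= d)%N -> (2 * d < L)%N -> (t + d <= 15)%N -> (L < 3 + (t + 3) * d.-1)%N ->
  star_beats t d L -> ~~ exceptional t d L ->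
  (d.-1 ^ (t + d).-1 * (t + 3) ^ (t + d) < 2 ^ (t + d) * (L - 3) ^ (t + d).-1)%N.
Proof.
move=> t2 d2 dL k15 Lu.
pose chk (t d L : nat) :=
  if (L <= 2 * d)%N || (15 < t + d)%N then true
  else if Z.ltb (Z.pow (Z.of_nat (L - d.+1)) (Z.of_nat (t + d)) * Z.of_nat L)
        (Z.pow (Z.of_nat t) (Z.of_nat (t + d)) * Z.pow (Z.of_nat d) (Z.of_nat (t + d).+1))
  then true else if exceptional t d L then true
  else Z.ltb (Z.pow (Z.of_nat d.-1) (Z.of_nat (t + d).-1) *
              Z.pow (Z.of_nat (t + 3)) (Z.of_nat (t + d)))
        (Z.pow (Z.of_nat 2) (Z.of_nat (t + d)) * Z.pow (Z.of_nat (L - 3)) (Z.of_nat (t +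
            d).-1)).
have H : all (fun t => all (fun d => all (chk t d) (iota 0 250)) (iota 2 13)) (iota 2 13).
  by vm_compute.
move: H => /allP/(_ t); rewrite mem_iota => /(_ ltac:(lia)).
move=> /allP/(_ d); rewrite mem_iota => /(_ ltac:(lia)).
move=> /allP/(_ L); rewrite mem_iota => /(_ ltac:(nia)).
rewrite /chk ifF; last by lia.
case: ifP => [/Z.ltb_lt h _|_].
  rewrite /star_beats leq_Z => /Z.leb_le; rewrite !Z_of_nat_muln !Z_of_nat_expn => h2.
  by move/Z.lt_nge: h.
case: ifP => // _ /Z.ltb_lt h _ _.
by rewrite ltn_Z; apply/Z.ltb_lt; rewrite !Z_of_nat_muln !Z_of_nat_expn.
Qed.

(** This is the contraction needed, with [zeta = 1], in the hardest middle case: segment of size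
    [t + 3] and critical sets of size [t + 1], kept with fraction [2 / (t + 3)]. *)
Lemma star_beats_mid2 (t d L : nat) :
  (2 <= t)%N -> (2 <= d)%N -> (2 * d < L)%N -> star_beats t d L ->
  ~~ exceptional t d L ->
  ((t + 3) ^ (t + d) * d.-1 ^ (t + d).-1 < 2 ^ (t + d) * (L - 3) ^ (t + d).-1)%N.
Proof.
move=> t2 d2 dL; set k := (t + d)%N => st ex.
have k4 : (4 <= k)%N by rewrite /k; lia.
have kE : k = k.-1.+1 by rewrite prednK //; lia.
have d1 : (0 < d.-1)%N by lia.
(* Here [(L - 3) / (d - 1) >= t + 3], and [t + 3 < 2 ^ k] is enough. The other case bounds [L], so
   that small [k] leave finitely many triples. *)
have [Lu|Lu] := ltnP L (3 + (t + 3) * d.-1); last first.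
  apply: (@leq_ltn_trans ((t + 3) * (((t + 3) * d.-1) ^ k.-1))).
    by rewrite expnMn mulnA -expnS -kE.
  apply: (@leq_ltn_trans ((t + 3) * ((L - 3) ^ k.-1))).
    by rewrite leq_mul2l leq_expn2r ?orbT //; lia.
  rewrite ltn_pmul2r ?expn_gt0; last by rewrite subn_gt0; apply/orP; left; nia.
  have : (k.-1 < 2 ^ k.-1)%N by exact: ltn_expl.
  have : (2 ^ k = 2 * 2 ^ k.-1)%N by rewrite -expnS -kE.
  by rewrite /k; lia.
have [k15|k16] := leqP k 15.
  by rewrite mulnC; apply: star_beats_small.
have tk : (t + 2 <= k)%N by rewrite /k; lia.
(* Above the ratio [(2 t + 4) / 3] the claim follows from the ratio alone; below it [star_beats]
   fails. *)
have [Lg|Lg] := leqP ((2 * t + 4) * d.-1) (3 * (L - 3)).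
  apply: (leq_exp_ratio (A := 3) (B := 2 * t + 4)); first by rewrite mulnC.
    by nia.
  have h := expn_frankl2_ratio t2 k16 tk.
  have p3 : (0 < 3 * (2 * t + 4))%N by rewrite muln_gt0 addn_gt0 orbT.
  rewrite -(ltn_pmul2r p3).
  rewrite [X in (X < _)%N](_ : _ = (2 * t + 4) * (3 * t + 9) ^ k)%N; last first.
    have -> : (3 * t + 9 = 3 * (t + 3))%N by lia.
    have e3 : (3 ^ k = 3 * 3 ^ k.-1)%N by rewrite -expnS -kE.
    by rewrite expnMn e3; ring.
  rewrite [X in (_ < X)%N](_ : _ = 3 * (4 * t + 8) ^ k)%N //.
  have -> : (4 * t + 8 = 2 * (2 * t + 4))%N by lia.
  have e2 : ((2 * t + 4) ^ k = (2 * t + 4) * (2 * t + 4) ^ k.-1)%N by rewrite -expnS -kE.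
  by rewrite expnMn e2; ring.
exfalso; have h := expn_star_ratio t2 k16 tk.
move: st; rewrite /star_beats -/k leqNgt => /negP; apply.
have L1 : (3 * (L - d.+1) < (2 * t + 1) * d)%N.
  have -> : d = d.-1.+1 by lia.
  by nia.
have L2 : (L < t.+1 * d)%N.
  have dE : d = d.-1.+1 by lia.
  by rewrite dE; nia.
have p3 : (0 < 3 ^ k)%N by rewrite expn_gt0.
rewrite -(ltn_pmul2l p3) !mulnA -!expnMn.
apply: (@leq_ltn_trans (((2 * t + 1) * d) ^ k * L)).
  by rewrite leq_mul2r leq_expn2r ?orbT // ltnW.
apply: (@leq_trans (((2 * t + 1) * d) ^ k * (t.+1 * d))).
  by rewrite ltn_pmul2l // expn_gt0; apply/orP; left; lia.
rewrite !expnMn expnS.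
rewrite [X in (X <= _)%N](_ : _ = (t.+1 * (2 * t + 1) ^ k) * (d * d ^ k))%N; last by ring.
by rewrite leq_mul2r -expnMn h orbT.
Qed.

(** The extreme case for large critical sets is [m = t + 2], [a = t + 1]. Since [5 <= t + 3], it
    follows from the middle case outside the two exceptions. *)
Lemma star_beats_low (t d L : nat) :
  (2 <= t)%N -> (2 <= d)%N -> (2 * d < L)%N -> star_beats t d L ->
  (5 ^ (t + d) * d.-1 ^ (t + d).-1 < 2 ^ (t + d) * (L - 2) ^ (t + d).-1)%N.
Proof.
move=> t2 d2 dL st; have [ex|ex] := boolP (exceptional t d L).
  by case/orP: ex => /eqP[-> -> ->]; nat_vm.
have := star_beats_mid2 t2 d2 dL st ex.
have : (5 ^ (t + d) <= (t + 3) ^ (t + d))%N by rewrite leq_expn2r //; lia.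
have : ((L - 3) ^ (t + d).-1 <= (L - 2) ^ (t + d).-1)%N by rewrite leq_expn2r //; lia.
move: ((L - 3) ^ _)%N ((L - 2) ^ _)%N (5 ^ _)%N ((t + 3) ^ _)%N (2 ^ _)%N (d.-1 ^ _)%N.
move=> u u' v v' w z; nia.
Qed.

(** The extreme case for small critical sets is [a = t], [m = t + d]: for larger [m] the
    complementary size would reach [k], and size [t] would be free. *)
Lemma star_beats_high (t d L : nat) :
  (2 <= t)%N -> (2 <= d)%N -> (2 * d < L)%N -> star_beats t d L ->
  (5 ^ (t + d) * d ^ (t + d).-1 < 3 ^ (t + d) * (L - d) ^ (t + d).-1)%N.
Proof.
move=> t2 d2 dL; set k := (t + d)%N => st.
have k4 : (4 <= k)%N by rewrite /k; lia.
have kE : k = k.-1.+1 by rewrite prednK //; lia.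
have d0 : (0 < d)%N by lia.
(* At ratio 1/2 the claim is [2 * 5 ^ k < 6 ^ k], which holds from [k = 4] on. *)
have [L3|L3] := leqP (3 * d) L.
  apply: (leq_exp_ratio (A := 1) (B := 2)); [by lia|by lia|].
  rewrite exp1n muln1 -(ltn_pmul2r (isT : 0 < 2)%N) -mulnA [(2 ^ _ * 2)%N]mulnC.
  rewrite -expnS -kE -expnMn -(subnK k4).
  elim: (k - 4)%N => [|j IHj]; first by nat_vm.
  by rewrite addSn [X in (X * _)%N]expnS [X in (_ < X)%N]expnS; move: IHj;
      move: (5 ^ _)%N ((3 * 2) ^ _)%N => u v; lia.
have [k10|k11] := leqP k 10; last first.
  (* Otherwise [L < 3 d] would contradict [star_beats], because [3 * 9 ^ k <= 10 ^ k] for [k >= 11];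
     the ratio 5/9 then suffices. *)
  have d9 : (9 * d <= 5 * (L - d))%N.
    rewrite leqNgt; apply/negP => d9.
    move: st; rewrite /star_beats -/k leqNgt => /negP; apply.
    have p5 : (0 < 5 ^ k)%N by rewrite expn_gt0.
    rewrite -(ltn_pmul2l p5) !mulnA -!expnMn.
    apply: (@leq_ltn_trans ((9 * d) ^ k * L)).
      by rewrite leq_mul2r leq_expn2r ?orbT //; lia.
    apply: (@leq_trans ((9 * d) ^ k * (3 * d))).
      by rewrite ltn_pmul2l // expn_gt0; apply/orP; left; lia.
    apply: (@leq_trans ((5 * 2) ^ k * d ^ k.+1)); last first.
      by rewrite leq_mul2r leq_expn2r ?orbT // leq_mul2l t2.
    rewrite [(9 * d)%N]mulnC expnMn [X in (_ <= X)%N]mulnC expnS.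
    rewrite [X in (X <= _)%N](_ : _ = (d * d ^ k) * (3 * 9 ^ k))%N; last by ring.
    rewrite leq_mul2l; apply/orP; right.
    rewrite -(subnK k11); elim: (k - 11)%N => [|j IHj]; first by nat_vm.
    by rewrite addSn ![(_ ^ (_ + _).+1)%N]expnS; move: IHj;
        move: (9 ^ _)%N ((5 * 2) ^ _)%N => u v; lia.
  apply: (leq_exp_ratio (A := 5) (B := 9)); [by lia|by lia|].
  rewrite -(ltn_pmul2r (isT : 0 < 9 * 5)%N).
  rewrite [X in (X < _)%N](_ : _ = 9 * (5 * 5) ^ k)%N; last first.
    have e5 : (5 ^ k = 5 * 5 ^ k.-1)%N by rewrite -expnS -kE.
    by rewrite expnMn e5; ring.
  rewrite [X in (_ < X)%N](_ : _ = 5 * (3 * 9) ^ k)%N; last first.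
    have e9 : (9 ^ k = 9 * 9 ^ k.-1)%N by rewrite -expnS -kE.
    by rewrite expnMn e9; ring.
  rewrite -(subnK k11); elim: (k - 11)%N => [|j IHj]; first by nat_vm.
  by rewrite addSn ![(_ ^ (_ + _).+1)%N]expnS; move: IHj;
      move: ((5 * 5) ^ _)%N ((3 * 9) ^ _)%N => u v; lia.
pose chk (t d L : nat) :=
  if (L <= 2 * d)%N || (10 < t + d)%N then true
  else if Z.ltb (Z.pow (Z.of_nat (L - d.+1)) (Z.of_nat (t + d)) * Z.of_nat L)
        (Z.pow (Z.of_nat t) (Z.of_nat (t + d)) * Z.pow (Z.of_nat d) (Z.of_nat (t + d).+1))
  then true
  else Z.ltb (Z.pow (Z.of_nat 5) (Z.of_nat (t + d)) * Z.pow (Z.of_nat d) (Z.of_nat (t + d).-1))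
        (Z.pow (Z.of_nat 3) (Z.of_nat (t + d)) * Z.pow (Z.of_nat (L - d)) (Z.of_nat (t +
            d).-1)).
have H : all (fun t => all (fun d => all (chk t d) (iota 0 30)) (iota 2 9)) (iota 2 9).
  by vm_compute.
have lt8 : (t < 11)%N by rewrite /k in k10; lia.
have ld8 : (d < 11)%N by rewrite /k in k10; lia.
have lL8 : (L < 30)%N by rewrite /k in k10; lia.
move: H => /allP/(_ t); rewrite mem_iota t2 => /(_ lt8).
move=> /allP/(_ d); rewrite mem_iota d2 => /(_ ld8).
move=> /allP/(_ L); rewrite mem_iota /= => /(_ lL8).
rewrite /chk ifF; last by move: k10; rewrite /k; lia.
case: ifP => [/Z.ltb_lt h _|_ /Z.ltb_lt h].
  move: st; rewrite /star_beats leq_Z => /Z.leb_le; rewrite !Z_of_nat_muln !Z_of_nat_expn => h2.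
  by move/Z.lt_nge: h.
by rewrite ltn_Z; apply/Z.ltb_lt; rewrite !Z_of_nat_muln !Z_of_nat_expn.
Qed.

(** * Contraction for large, small and middle critical sets *)

Lemma contracts_ratio (k l M p q : nat) :
  (0 < l <= M)%N -> (q ^ k * l ^ k.-1 < p ^ k * M ^ k.-1)%N -> contracts k l M p q.
Proof.
move=> /andP[l0 lM] h; exists 1%N, 1%N; split => //; rewrite ?exp1n ?muln1 //.
by rewrite mul1n; nia.
Qed.

Lemma contracts_large (t d L m a : nat) :
  (2 <= t)%N -> (2 * d < L)%N -> star_beats t d L ->
  (t + 2 <= m)%N -> (m < t + 2 * d)%N -> (a < t + d)%N -> (m + t - 1 < 2 * a)%N ->
  contracts (t + d) (t + d - a) (t + L - m) 2 5.
Proof.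
move=> t2 dL st tm md ad ma; have d2 : (2 <= d)%N by lia.
apply: contracts_ratio; first by lia.
apply: (leq_exp_ratio (A := d.-1) (B := L - 2)); last exact: star_beats_low.
  have [p ap] : exists p, a = (t + p.+1)%N by exists (a - t.+1)%N; lia.
  have [e de] : exists e, d = (p.+2 + e)%N by exists (d - p.+2)%N; lia.
  apply: (@leq_trans (d.-1 * (L - 2 * p.+1))); last by rewrite leq_mul2l; lia.
  subst a d; have [f fE] : exists f, L = (2 * (p.+2 + e) + f.+1)%N.
    by exists (L - (2 * (p.+2 + e)).+1)%N; lia.
  rewrite fE (_ : t + (p.+2 + e) - (t + p.+1) = e.+1)%N; last by lia.
  rewrite (_ : 2 * (p.+2 + e) + f.+1 - 2 = 2 * p + 2 * e + f + 3)%N; last by lia.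
  rewrite (_ : 2 * (p.+2 + e) + f.+1 - 2 * p.+1 = 2 * e + f + 3)%N; last by lia.
  by rewrite /=; nia.
by lia.
Qed.

Lemma contracts_small (t d L m a : nat) :
  (2 <= t)%N -> (2 * d < L)%N -> star_beats t d L ->
  (t + 2 <= m)%N -> (m < t + 2 * d)%N -> (t <= a)%N -> (2 * a < m + t - 1)%N ->
  (m + t - 1 - a < t + d)%N ->
  contracts (t + d) (t + d - a) (t + L - m) 3 5.
Proof.
move=> t2 dL st tm md ta ma mda; have d2 : (2 <= d)%N by lia.
apply: contracts_ratio; first by lia.
apply: (leq_exp_ratio (A := d) (B := L - d)); last exact: star_beats_high.
  apply: (@leq_trans (d * (t + L - (a + d)))); last by rewrite leq_mul2l; lia.
  have [p ap] : exists p, a = (t + p)%N by exists (a - t)%N; lia.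
  subst a; have [e de] : exists e, d = (p + e)%N by exists (d - p)%N; lia.
  subst d; have [f fE] : exists f, L = (2 * (p + e) + f)%N.
    by exists (L - (2 * (p + e)))%N; lia.
  rewrite fE (_ : t + (p + e) - (t + p) = e)%N; last by lia.
  rewrite (_ : 2 * (p + e) + f - (p + e) = p + e + f)%N; last by lia.
  rewrite (_ : t + (2 * (p + e) + f) - (t + p + (p + e)) = e + f)%N; last by lia.
  by nia.
by lia.
Qed.

(** The fraction [(m - a) / m] is the proportion of the segment that lies outside a set of size [a].
    With [a = t + s + 1] and [m = t + 2 s + 3], the case [s = 0] is the worst, because
    [2 * d < L]. *)
Lemma contracts_middle (t d L m a : nat) :
  (2 <= t)%N -> (2 * d < L)%N -> star_beats t d L ->
  (t + 2 <= m)%N -> (m < t + 2 * d)%N -> (a < t + d)%N -> (2 * a = m + t - 1)%N ->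
  contracts (t + d) (t + d - a) (t + L - m) (m - a) m.
Proof.
move=> t2 dL st tm md ad ma; have d2 : (2 <= d)%N by lia.
have [s sE] : exists s, a = (t + s.+1)%N by exists (a - t.+1)%N; lia.
have mE : m = (t + 2 * s + 3)%N by lia.
subst a m; rewrite (_ : t + 2 * s + 3 - (t + s.+1) = s.+2)%N; last by lia.
have [ex|ex] := boolP (exceptional t d L).
  case/orP: ex => /eqP[tE dE LE]; subst t d L; clear st.
    have s2 : (s < 2)%N by lia.
    clear tm md ad ma; case: s s2 => [|[|s]] s2; last by [].
      (* The optimal [zeta] has [k]-th power 3/5 here and 3/4 in the other exceptional case; 24/25
         is a rational upper bound for both. *)
      by exists 24%N, 25%N; (split; [by []|by []|nat_vm|nat_vm]).
    by apply: contracts_ratio; [by []|nat_vm].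
  have s3 : (s < 3)%N by lia.
  clear tm md ad ma; case: s s3 => [|[|[|s]]] s3; last by [].
  - by exists 24%N, 25%N; (split; [by []|by []|nat_vm|nat_vm]).
  - by apply: contracts_ratio; [by []|nat_vm].
  - by apply: contracts_ratio; [by []|nat_vm].
apply: contracts_ratio; first by lia.
have st2 := star_beats_mid2 t2 d2 dL st ex.
have ms : ((t + 2 * s + 3) * 2 <= s.+2 * (t + 3))%N by nia.
have k0 : (0 < t + d)%N by lia.
have h1 : ((t + 2 * s + 3) ^ (t + d) * d.-1 ^ (t + d).-1 < s.+2 ^ (t + d) * (L - 3) ^ (t +
    d).-1)%N.
  have p2 : (0 < 2 ^ (t + d))%N by rewrite expn_gt0.
  rewrite -(ltn_pmul2r p2) mulnAC -expnMn.
  apply: (@leq_ltn_trans ((s.+2 * (t + 3)) ^ (t + d) * d.-1 ^ (t + d).-1)).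
    by rewrite leq_mul2r leq_expn2r ?orbT.
  by rewrite expnMn -!mulnA ltn_pmul2l ?expn_gt0 // [X in (_ < X)%N]mulnC.
apply: (leq_exp_ratio _ _ h1); last by lia.
have [e de] : exists e, d = (s.+2 + e)%N by exists (d - s.+2)%N; lia.
subst d; have [f fE] : exists f, L = (2 * (s.+2 + e) + f.+1)%N.
  by exists (L - (2 * (s.+2 + e)).+1)%N; lia.
rewrite fE (_ : t + (s.+2 + e) - (t + s.+1) = e.+1)%N; last by lia.
rewrite (_ : 2 * (s.+2 + e) + f.+1 - 3 = 2 * s + 2 * e + f + 2)%N; last by lia.
rewrite (_ : t + (2 * (s.+2 + e) + f.+1) - (t + 2 * s + 3) = 2 * e + f + 2)%N; last by lia.
by rewrite /=; nia.
Qed.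

(** * Shifted up-sets *)

Definition upset (n : nat) (U : {set {set 'I_n}}) : Prop :=
  forall A B : {set 'I_n}, A \in U -> A \subset B -> B \in U.

Definition shifted (n : nat) (U : {set {set 'I_n}}) : Prop :=
  forall (i j : 'I_n) (A : {set 'I_n}),
    (i < j)%N -> j \in A -> i \notin A -> A \in U -> (i |: A :\ j)%SET \in U.

(** For an up-set this says that membership depends only on the trace on the first [m] elements. *)
Definition based (n m : nat) (U : {set {set 'I_n}}) : Prop :=
  forall A : {set 'I_n}, A \in U -> A :&: segment n m \in U.

Lemma card_segment (n m : nat) : (m <= n)%N -> #|segment n m| = m.
Proof.
move=> mn; rewrite -[RHS]card_ord -(card_image (f := widen_ord mn)).
  apply: eq_card => i; rewrite inE; apply/idP/imageP => [im|[j _ ->]] //=.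
  by exists (Ordinal im) => //; apply: val_inj.
by move=> i j /(congr1 val) /= ij; apply: val_inj.
Qed.

Lemma card_setC_segment (n m : nat) : (m <= n)%N -> #|~: segment n m| = (n - m)%N.
Proof. by move=> mn; rewrite cardsCs setCK card_segment ?card_ord. Qed.

Lemma segmentS (n m : nat) (mn : (m < n)%N) :
  segment n m.+1 = (Ordinal mn |: segment n m)%SET.
Proof. by apply/setP => i; rewrite !inE -val_eqE /= ltnS leq_eqVlt. Qed.

Lemma t_intersectingP (n t : nat) (F : {set {set 'I_n}}) :
  reflect (forall A B, A \in F -> B \in F -> (t <= #|A :&: B|)%N)
    (t_intersecting t F).
Proof.
apply: (iffP forall_inP) => [h A B /h /forall_inP|h A AF]; first by apply.
by apply/forall_inP => B; apply: h.
Qed.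

Lemma uniformP (n k : nat) (F : {set {set 'I_n}}) :
  reflect (forall A, A \in F -> #|A| = k) (uniform k F).
Proof. by apply: (iffP forall_inP) => h A /h /eqP. Qed.

Section Critical.
Variables (n t m : nat) (mn : (m < n)%N) (U : {set {set 'I_n}}).
Hypotheses (Uup : upset U) (Ush : shifted U) (Ut : t_intersecting t U).
Hypothesis Ub : based m.+1 U.

Let S := segment n m.
Let e := Ordinal mn.

(* The traces on [S] whose membership in [U] is decided by [e]. *)
Definition critical : {set {set 'I_n}} :=
  [set A : {set 'I_n} | [&& A \subset S, A \notin U & e |: A \in U]]%SET.

Lemma mem_e_segment : e \notin S.
Proof. by rewrite inE ltnn. Qed.

Lemma critical_notin (A : {set 'I_n}) : A \subset S -> e \notin A.
Proof. by move=> /subsetP AS; apply/negP => /AS; rewrite (negbTE mem_e_segment). Qed.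

(* Two critical sets that may not be added to [U] together are complementary up to [t],
   so their sizes determine each other: this is what makes the pushing-pulling
   replacement of one size by the complementary one possible. *)
Lemma critical_card (A B : {set 'I_n}) :
  A \in critical -> B \in critical -> (#|A :&: B| < t)%N ->
  A :|: B = S /\ (#|A| + #|B| = m + t - 1)%N.
Proof.
rewrite !inE => /and3P[AS AU eA] /and3P[BS BU eB] AB.
have eAN := critical_notin AS; have eBN := critical_notin BS.
have h : (t <= #|A :&: B|.+1)%N.
  have /t_intersectingP/(_ _ _ eA eB) := Ut.
  by rewrite -setUIr cardsU1 inE (negbTE eAN).
have AUB : A :|: B = S.
  apply/eqP; rewrite eqEsubset subUset AS BS /=; apply/subsetP => i iS.
  rewrite inE; apply: contraT; rewrite negb_or => /andP[iA iB].
  have ie : (i < e)%N by move: iS; rewrite inE.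
  have iAU : (i |: A)%SET \in U.
    have := Ush ie (setU11 e A) _ eA; rewrite setU1K //; apply.
    by rewrite !inE (negbTE iA) orbF neq_ltn ie.
  have /t_intersectingP/(_ _ _ iAU eB) := Ut; rewrite leqNgt.
  rewrite (_ : (i |: A) :&: (e |: B) = A :&: B)%SET ?AB //.
  apply/setP => j; rewrite !inE; case: (eqVneq j i) => [->|_] /=.
    by rewrite (negbTE iA) (negbTE iB) /= orbF -val_eqE (ltn_eqF ie).
  by case: (eqVneq j e) => [->|_] //=; rewrite (negbTE eAN).
split=> //; have := cardsUI A B; rewrite AUB card_segment; [lia|exact: ltnW].
Qed.

Lemma critical_cardT (A : {set 'I_n}) :
  (t < m)%N -> A \in critical -> (t <= #|A|)%N.
Proof.
move=> tm AC; rewrite leqNgt; apply/negP => At.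
have [] := critical_card AC AC; rewrite ?setIid ?setUid // => AS _.
by move: At; rewrite AS card_segment; [lia|exact: ltnW].
Qed.

Lemma critical_setU1 (A : {set 'I_n}) (i : 'I_n) :
  A \in critical -> i \in S -> i \notin A -> (i |: A)%SET \in U.
Proof.
rewrite !inE => /and3P[AS AU eA] iS iA; have ie : (i < e)%N by [].
have := Ush ie (setU11 e A) _ eA; rewrite setU1K ?critical_notin //; apply.
by rewrite !inE (negbTE iA) orbF neq_ltn ie.
Qed.

Lemma mem_critical (A : {set 'I_n}) :
  A \in U -> A :&: S \notin U -> (e \in A) && (A :&: S \in critical).
Proof.
move=> AU AS; have := Ub AU; rewrite segmentS setIUr.
case eA: (e \in A); last first.
  rewrite (_ : A :&: [set e] = set0) ?set0U ?(negbTE AS) //.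
  by apply/setP => i; rewrite !inE; case: eqP => [->|]; rewrite ?eA ?andbF.
rewrite (_ : A :&: [set e] = [set e])%SET => [eAU|]; last first.
  by apply/setIidPr; rewrite sub1set eA.
by rewrite inE subsetIr AS.
Qed.

Definition rebase (W : {set {set 'I_n}}) : {set {set 'I_n}} :=
  [set B : {set 'I_n} | (B :&: S \in U) || (B :&: S \in W)]%SET.

(** Removing [e] from a critical set costs nothing against a member of [U] inside [S], which does
    not contain [e]; only two critical sets can conflict. *)
Lemma t_intersecting_rebase (W : {set {set 'I_n}}) :
  W \subset critical -> (forall A B, A \in W -> B \in W -> (t <= #|A :&: B|)%N) ->
  t_intersecting t (rebase W).
Proof.
move=> /subsetP WC Wt; apply/t_intersectingP => A B.
have mix P Q : P \in U -> P \subset S -> Q \in W -> (t <= #|P :&: Q|)%N.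
  move=> PU PS QW; have := WC _ QW; rewrite inE => /and3P[QS _ eQ].
  have /t_intersectingP/(_ _ _ PU eQ) := Ut.
  rewrite (_ : P :&: (e |: Q) = P :&: Q)%SET //.
  apply/setP => j; rewrite !inE; case: (eqVneq j e) => [->|_] //=.
  by rewrite (negbTE (critical_notin PS)).
move=> AH BH; apply: (@leq_trans #|(A :&: S) :&: (B :&: S)|); last first.
  by apply: subset_leq_card; rewrite setISS // subsetIl.
move: AH BH; rewrite !inE => /orP[AU|AW] /orP[BU|BW].
- by have /t_intersectingP := Ut; apply.
- by apply: mix => //; rewrite subsetIr.
- by rewrite setIC; apply: mix => //; rewrite subsetIr.
- exact: Wt.
Qed.

(** A trace strictly larger than a critical one is already in [U]: shift [e] to an additional
    element. *)
Lemma upset_rebase (W : {set {set 'I_n}}) : W \subset critical -> upset (rebase W).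
Proof.
move=> /subsetP WC A B; rewrite !inE => /orP[AU|AW] AB.
  by rewrite (Uup AU) // setSI.
case: (eqVneq (A :&: S) (B :&: S)) => [<-|ne]; first by rewrite AW orbT.
have /properP[ABs [i iB iA]] : A :&: S \proper B :&: S by rewrite properEneq ne setSI.
rewrite (@Uup (i |: (A :&: S))%SET) //; last by rewrite subUset sub1set iB.
apply: critical_setU1 => //; first exact: WC.
by move: iB; rewrite inE => /andP[].
Qed.

Lemma based_rebase (W : {set {set 'I_n}}) : based m (rebase W).
Proof. by move=> A; rewrite !inE -setIA setIid. Qed.

(** Shifting a critical trace yields a member of [U] or a critical trace of the same size, so a
    selection by size alone is preserved. *)
Lemma shifted_rebase (P : pred nat) :
  shifted (rebase [set A in critical | P #|A|]%SET).
Proof.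
set W := [set A in critical | P #|A|]%SET.
have WC : W \subset critical by apply/subsetP => A; rewrite inE => /andP[].
move=> i j A ij jA iA AH.
have [jS|jS] := boolP (j \in S); last first.
  apply: (upset_rebase WC (based_rebase AH)).
  apply/subsetP => l; rewrite !inE => /andP[lA lm].
  rewrite lA andbT; case: (eqVneq l i) => //= _.
  by apply: contraNneq jS => <-; rewrite inE.
have iS : i \in S by move: jS; rewrite !inE; apply: ltn_trans.
have iAS : i \notin A :&: S by rewrite inE (negbTE iA).
have jAS : j \in A :&: S by rewrite inE jA.
have sE : ((i |: A :\ j) :&: S = i |: (A :&: S) :\ j)%SET.
  apply/setP => l; rewrite !inE; case: (eqVneq l i) => [->|] /=.
    by move: iS; rewrite inE.
  by rewrite andbA.
have memH B : (B \in rebase W) = (B :&: S \in U) || (B :&: S \in W) by rewrite inE.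
move: AH; rewrite !memH sE => /orP[AU|].
  by rewrite Ush.
rewrite inE => /andP[]; rewrite inE => /and3P[AS AU eA] PA.
case AU' : (i |: (A :&: S) :\ j \in U)%SET => //=.
rewrite !inE AU' /=; apply/andP; split; last first.
  rewrite cardsU1 !inE (negbTE iA) andbF /=.
  by move: PA; rewrite (cardsD1 j (A :&: S)) jAS.
apply/andP; split.
  rewrite subUset sub1set iS; apply: subset_trans (subsetIr A S).
  by rewrite subsetDl.
have eAS : e \notin A :&: S by apply: critical_notin; rewrite subsetIr.
have := @Ush i j (e |: (A :&: S))%SET ij; rewrite setU1r //.
have ie : i != e by rewrite neq_ltn; move: iS; rewrite inE => ->.
have je : j != e by rewrite neq_ltn; move: jS; rewrite inE => ->.
rewrite in_setU1 (negbTE ie) (negbTE iAS) => /(_ isT isT eA).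
rewrite (_ : (i |: (e |: A :&: S) :\ j) = (e |: (i |: (A :&: S) :\ j)))%SET //.
apply/setP => l; rewrite !inE; case: (eqVneq l i) => //= _; rewrite ?orbT //.
by case: (eqVneq l e) => [->|] //=; rewrite eq_sym je.
Qed.

End Critical.

(** * Weight of the sets with a prescribed trace *)

Lemma sum_fiber (R : realType) (T : finType) (z : T -> R) (S Q : {set T}) (k : nat)
    (P : pred {set T}) :
  Q \subset S -> (#|Q| <= k)%N ->
  \sum_(A : {set T} | [&& #|A| == k, A :&: S == Q & P (A :\: S)]) weight z A =
  weight z Q *
    \sum_(D : {set T} | [&& D \subset ~: S, #|D| == k - #|Q| & P D]%N) weight z D.
Proof.
move=> QS Qk; rewrite mulr_sumr.
rewrite (reindex_onto (fun D => Q :|: D)%SET (fun A => A :\: S)%SET) /=; last first.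
  by move=> A /and3P[_ /eqP <- _]; rewrite setID.
have DS (D : {set T}) : D \subset ~: S -> ((Q :|: D) :&: S = Q) /\ ((Q :|: D) :\: S = D).
  move=> /subsetP DS; split; apply/setP => i; rewrite !inE.
    case iQ: (i \in Q) => /=; first exact: (subsetP QS).
    by apply/negbTE/negP => /andP[/DS]; rewrite inE => /negbTE ->.
  case iD: (i \in D); first by have := DS _ iD; rewrite inE orbT => ->.
  by rewrite orbF; case iQ: (i \in Q); rewrite ?andbF // (subsetP QS).
have dQ (D : {set T}) : D \subset ~: S -> [disjoint Q & D].
  by move=> DS'; apply: disjointWl QS _; rewrite disjoint_sym disjoints_subset.
have cU (D : {set T}) : D \subset ~: S -> #|Q :|: D| = (#|Q| + #|D|)%N.
  by move=> /dQ dQD; rewrite cardsU disjoint_setI0 // cards0 subn0.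
rewrite (eq_bigl (fun D : {set T} => [&& D \subset ~: S, #|D| == k - #|Q| & P D]%N)) => [|D].
  by apply: eq_bigr => D /and3P[/dQ dQD _ _]; exact: weightU.
apply/idP/idP => [/andP[/and3P[cA _ PD] /eqP sD]|/and3P[DSS cD PD]].
    have DSS : D \subset ~: S by rewrite -sD setDE subsetIr.
    rewrite DSS -[X in P X]sD PD andbT /=; move: cA; rewrite cU // => /eqP <-.
    by rewrite addKn.
  have [-> ->] := DS _ DSS; rewrite !eqxx PD !andbT.
  by rewrite cU // (eqP cD) subnKC.
Qed.

(** * Pushing and pulling *)

(** The restriction to [k]-sets is part of the sum, so that up-sets can be weighed without passing
    to their [k]-subsets. *)
Definition fam_weight (R : realType) (n k : nat) (x : 'I_n -> R)
    (U : {set {set 'I_n}}) : R :=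
  \sum_(A in U | #|A| == k) weight x A.

(** Optimality over families and vectors together: competitors are weighed at a flattened vector,
    not at the given one. *)
Definition dominated (R : realType) (n k t : nat) (r : R) : Prop :=
  forall (H : {set {set 'I_n}}) (y : 'I_n -> R), t_intersecting t H ->
    (forall i, 0 <= y i) -> \sum_i y i ^+ k = 1 -> fam_weight k y H <= r.

Section Fibers.
Variables (R : realType) (n k m : nat) (mn : (m < n)%N).
Let S := segment n m.
Let e := Ordinal mn.

Definition fiber (z : 'I_n -> R) (Q : {set 'I_n}) : R :=
  \sum_(A : {set 'I_n} | (#|A| == k) && (A :&: S == Q)) weight z A.

Definition fiber_mem (z : 'I_n -> R) (Q : {set 'I_n}) : R :=
  \sum_(A : {set 'I_n} | [&& #|A| == k, A :&: S == Q & e \in A]) weight z A.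

Lemma fiberE (z : 'I_n -> R) (Q : {set 'I_n}) :
  Q \subset S -> (#|Q| <= k)%N ->
  fiber z Q = weight z Q * esum z (~: S) (k - #|Q|).
Proof.
move=> QS Qk; have := sum_fiber z xpredT QS Qk.
rewrite /esum /fiber; under eq_bigl do rewrite andbT; move=> ->.
by congr (_ * _); apply: eq_bigl => D; rewrite andbT.
Qed.

Lemma fiber_memE (z : 'I_n -> R) (Q : {set 'I_n}) :
  Q \subset S -> (#|Q| < k)%N ->
  fiber_mem z Q = weight z Q * (z e * esum z (~: S :\ e) (k - #|Q|).-1).
Proof.
move=> QS Qk; have := sum_fiber z (fun D => e \in D) QS (ltnW Qk).
have eS : e \in ~: S by rewrite inE mem_e_segment.
rewrite -{1}(prednK (n := k - #|Q|)) ?subn_gt0 // esum_mem // => <-.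
by apply: eq_bigl => A; rewrite inE (mem_e_segment mn).
Qed.

Lemma fiber_mem0 (z : 'I_n -> R) (Q : {set 'I_n}) :
  Q \subset S -> (k <= #|Q|)%N -> fiber_mem z Q = 0.
Proof.
move=> QS Qk; rewrite /fiber_mem big1 // => A /and3P[/eqP cA /eqP sA eA].
have : e |: Q \subset A by rewrite subUset sub1set eA -sA subsetIl.
by move=> /subset_leq_card; rewrite cardsU1 (critical_notin mn QS) cA leqNgt ltnS Qk.
Qed.

Lemma fiber_ge0 (z : 'I_n -> R) (Q : {set 'I_n}) :
  (forall i, 0 <= z i) -> 0 <= fiber z Q.
Proof. by move=> z0; apply: sumr_ge0 => A _; apply: weight_ge0. Qed.

Lemma fiber_mem_le (z : 'I_n -> R) (Q : {set 'I_n}) :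
  (forall i, 0 <= z i) -> fiber_mem z Q <= fiber z Q.
Proof.
move=> z0; rewrite /fiber (bigID (fun A : {set 'I_n} => e \in A)) /=.
rewrite (_ : fiber_mem z Q = \sum_(A : {set 'I_n} | (#|A| == k) && (A :&: S == Q) && (e \in
    A)) weight z A).
  by rewrite lerDl; apply: sumr_ge0 => A _; apply: weight_ge0.
by apply: eq_bigl => A; rewrite andbA.
Qed.

Lemma fam_weight_fiber (z : 'I_n -> R) (U W : {set {set 'I_n}}) :
  W \subset critical mn U ->
  fam_weight k z (rebase m U W) =
  \sum_(Q in U | Q \subset S) fiber z Q + \sum_(Q in W) fiber z Q.
Proof.
move=> /subsetP WC; rewrite /fam_weight.
rewrite (partition_big (fun A => A :&: S) (fun Q =>
    (Q \in U) && (Q \subset S) || (Q \in W))) /=; last first.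
  by move=> A; rewrite inE subsetIr andbT => /andP[].
rewrite (bigID (fun Q => Q \in W)) /= addrC; congr (_ + _).
  apply: eq_big => [Q|Q].
    case QW: (Q \in W); rewrite ?andbF ?orbF ?andbT //.
    by move: (WC _ QW); rewrite inE => /and3P[_ /negbTE ->].
  case/andP=> QUW QW; rewrite /fiber; apply: eq_bigl => A.
  case: (eqVneq (A :&: S) Q) => [AQ|]; rewrite ?andbF ?andbT // inE AQ.
  by move: QUW; rewrite (negbTE QW) orbF => /andP[-> _].
apply: eq_big => [Q|Q]; first by case: (Q \in W); rewrite ?orbT ?andbF.
case/andP=> _ QW; rewrite /fiber; apply: eq_bigl => A.
by case: (eqVneq (A :&: S) Q) => [AQ|]; rewrite ?andbF ?andbT // inE AQ QW orbT.
Qed.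

(** Over a trace in [U] the whole fiber belongs to [U]; over a critical trace exactly the part
    containing [e] does; over any other trace nothing does. *)
Lemma fam_weight_critical (z : 'I_n -> R) (U : {set {set 'I_n}}) :
  upset U -> based m.+1 U ->
  fam_weight k z U =
  \sum_(Q in U | Q \subset S) fiber z Q + \sum_(Q in critical mn U) fiber_mem z Q.
Proof.
move=> Uup Ub; rewrite /fam_weight.
rewrite (partition_big (fun A => A :&: S) (fun Q =>
    (Q \in U) && (Q \subset S) || (Q \in critical mn U))) /=; last first.
  move=> A /andP[AU _]; rewrite subsetIr andbT; apply/orP.
  case AS: (A :&: S \in U); [by left|right].
  by have /andP[] := @mem_critical _ _ mn U Ub A AU (negbT AS).
rewrite (bigID (fun Q => Q \in critical mn U)) /= addrC; congr (_ + _).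
  apply: eq_big => [Q|Q].
    case QW: (Q \in critical mn U); rewrite ?andbF ?orbF ?andbT //.
    by move: QW; rewrite inE => /and3P[_ /negbTE ->].
  case/andP=> QUW QW; rewrite /fiber; apply: eq_bigl => A.
  case: (eqVneq (A :&: S) Q) => [AQ|]; rewrite ?andbF ?andbT //.
  move: QUW; rewrite (negbTE QW) orbF => /andP[QU _].
  by rewrite (Uup _ _ QU) // -AQ subsetIl.
apply: eq_big => [Q|Q]; first by case: (Q \in critical mn U); rewrite ?orbT ?andbF.
case/andP=> _ QC; rewrite /fiber_mem; apply: eq_bigl => A.
case: (eqVneq (A :&: S) Q) => [AQ|]; rewrite ?andbF ?andbT // andbC.
case cA: (#|A| == k) => //=; apply/idP/idP => [AU|eA].
  have := @mem_critical _ _ mn U Ub A AU; rewrite -/S AQ.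
  by move: QC; rewrite inE => /and3P[_ QU _] /(_ QU) /andP[].
move: QC; rewrite inE => /and3P[_ _ /Uup]; apply.
by rewrite subUset sub1set eA -AQ subsetIl.
Qed.

End Fibers.

(** * Making the tail of the vector constant *)

Section Flatten.
Variables (R : realType) (n k m : nat) (mn : (m < n)%N) (x : 'I_n -> R).
Hypotheses (k0 : (0 < k)%N) (x0 : forall i, 0 <= x i).
Let S := segment n m.
Let e := Ordinal mn.

Let beta : R := ((\sum_(i in ~: S) x i ^+ k) / (n - m)%:R) `^ k%:R^-1.

Definition flatten_tail (i : 'I_n) : R := if i \in S then x i else beta.

Let beta_ge0 : 0 <= beta. Proof. exact: powR_ge0. Qed.

Lemma sum_tail : \sum_(i in ~: S) x i ^+ k = #|~: S|%:R * beta ^+ k.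
Proof.
have nm0 : (0 : R) < (n - m)%:R by rewrite ltr0n subn_gt0.
rewrite -powR_mulrn // -powRrM mulVf ?pnatr_eq0 -?lt0n // powRr1.
  by rewrite (card_setC_segment (ltnW mn)) mulrC divfK // gt_eqF.
by rewrite divr_ge0 // sumr_ge0 // => i _; rewrite exprn_ge0.
Qed.

Lemma flatten_tail_ge0 (i : 'I_n) : 0 <= flatten_tail i.
Proof. by rewrite /flatten_tail; case: ifP. Qed.

Lemma sum_flatten_tail : \sum_i flatten_tail i ^+ k = \sum_i x i ^+ k.
Proof.
rewrite (bigID (mem S)) [RHS](bigID (mem S)) /=; congr (_ + _).
  by apply: eq_bigr => i iS; rewrite /flatten_tail iS.
have -> : \sum_(i | i \notin S) x i ^+ k = \sum_(i in ~: S) x i ^+ k.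
  by apply: eq_bigl => i; rewrite in_setC.
rewrite sum_tail (eq_bigr (fun=> beta ^+ k)) => [|i /negbTE iS]; last first.
  by rewrite /flatten_tail iS.
rewrite sumr_const -[LHS]mulr_natl; congr (_%:R * _).
by apply: eq_card => i; rewrite [RHS]in_setC.
Qed.

Let weight_flatten (Q : {set 'I_n}) : Q \subset S -> weight flatten_tail Q = weight x Q.
Proof. by move=> /subsetP QS; apply: eq_weight => i /QS iS; rewrite /flatten_tail iS. Qed.

Let esum_flatten (l : nat) :
  esum flatten_tail (~: S) l = 'C(#|~: S|, l)%:R * beta ^+ l.
Proof. by apply: esum_const => i; rewrite in_setC /flatten_tail => /negbTE ->. Qed.

Lemma fiber_le_flatten (Q : {set 'I_n}) :
  Q \subset S -> fiber k m x Q <= fiber k m flatten_tail Q.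
Proof.
move=> QS; have [Qk|Qk] := leqP #|Q| k; last first.
  rewrite [X in X <= _]big1 ?fiber_ge0 // => [|A /andP[/eqP cA /eqP AQ]].
    exact: flatten_tail_ge0.
  by move: Qk; rewrite -AQ -cA ltnNge subset_leq_card // subsetIl.
rewrite !fiberE // weight_flatten // ler_wpM2l ?weight_ge0 // esum_flatten.
by apply: (esum_le_flat k0) => //; [exact: leq_subr|exact: sum_tail].
Qed.

Lemma fiber_mem_lt_flatten (Q : {set 'I_n}) (p q : nat) :
  Q \subset S -> (#|Q| < k)%N -> (0 < q)%N -> contracts k (k - #|Q|) (n - m) p q ->
  let X := fiber_mem k mn x Q in
  let Y := p%:R / q%:R * fiber k m flatten_tail Q in
  X <= Y /\ (X = Y -> X = 0).
Proof.
move=> QS Qk q0 con; have eS : e \in ~: S by rewrite inE mem_e_segment.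
have kQ : ((k - #|Q|).-1.+1 = k - #|Q|)%N by rewrite prednK // subn_gt0.
have := @esum_mem_lt R _ x (~: S) e beta k (k - #|Q|).-1 p q q0 _ eS x0 beta_ge0 sum_tail.
rewrite kQ (card_setC_segment (ltnW mn)) => /(_ (leq_subr _ _) con) [h1 h2].
rewrite fiber_memE // fiberE 1?ltnW // weight_flatten // esum_flatten (card_setC_segment
    (ltnW mn)).
rewrite [p%:R / q%:R * (_ * _)]mulrCA; split.
  by rewrite ler_wpM2l ?weight_ge0.
have [->|w0] := eqVneq (weight x Q) 0; first by rewrite !mul0r.
by move=> /(mulfI w0) /h2 ->; rewrite mulr0.
Qed.

End Flatten.

(* The size [q - a] complementary to [a] is too large to be a trace without [e], so a
   critical set of size [a] conflicts with no set of the family. *)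
Definition free_size (k q a : nat) : bool := (k <= q - a)%N.

(** Here [q] is the sum of two conflicting sizes, and [s] tells whether the smaller of two different
    ones is kept. Equal sizes cannot be separated by size, so [avoids] decides. *)
Definition selected (k q : nat) (s : bool) (a : nat) (avoids : bool) : bool :=
  free_size k q a ||
  ((a < k)%N && (if (2 * a == q)%N then avoids else (2 * a < q)%N == s)).

(** The hypothesis [q < 2 * k] prevents both sizes from being free. Conflicting selected sets
    therefore have equal size and both avoid the chosen point, although their union is the whole
    segment. *)
Lemma selected_conflict (k q a b : nat) (s u v : bool) :
  (a + b = q)%N -> (q < 2 * k)%N -> selected k q s a u -> selected k q s b v ->
  u /\ v.
Proof.
move=> <- qk; rewrite /selected /free_size addKn addnK.
case: (leqP k a) => ka; case: (leqP k b) => kb //=; first lia.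
by case: ((2 * a)%N =P (a + b)%N) => ha; case: ((2 * b)%N =P (a + b)%N) => hb;
    [by []| | |move=> /eqP <- /eqP hs]; exfalso; lia.
Qed.

(** An optimal family cannot be enlarged by a set of nonzero weight, so one inclusion suffices. *)
Lemma dominated_agree (R : realType) (n k t : nat) (x : 'I_n -> R) (r : R)
    (U V : {set {set 'I_n}}) :
  dominated n k t r -> (forall i, 0 <= x i) -> \sum_i x i ^+ k = 1 ->
  fam_weight k x U = r -> t_intersecting t V ->
  (forall A : {set 'I_n}, #|A| = k -> weight x A != 0 -> A \in U -> A \in V) ->
  forall A : {set 'I_n}, #|A| = k -> weight x A != 0 -> (A \in U) = (A \in V).
Proof.
move=> dom x0 x1 Ur Vt UV A cA wA; apply/idP/idP; first exact: UV.
move=> AV; apply: contraT => AU; have := dom _ _ Vt x0 x1; rewrite -Ur leNgt => /negP[].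
rewrite /fam_weight [X in _ < X](bigD1 A) ?AV ?cA //=.
rewrite ltr_pwDl ?lt0r ?wA ?weight_ge0 //.
rewrite [X in X <= _]big_mkcond [X in _ <= X]big_mkcond; apply: ler_sum => B _.
case: ifP => [/andP[BU cB]|_]; last by case: ifP => // _; exact: weight_ge0.
have [->|wB] := eqVneq (weight x B) 0; first by case: ifP.
by rewrite (UV B) ?(eqP cB) // eqxx /=; case: eqP BU AU => [->|] // -> .
Qed.

Lemma descend (R : realType) (n k t m : nat) (x : 'I_n -> R) (r : R)
    (U : {set {set 'I_n}}) :
  (2 <= t)%N -> (t < k)%N -> (2 * k - t < n)%N -> star_beats t (k - t) (n - t) ->
  (t + 2 <= m)%N -> (m < 2 * k - t)%N ->
  dominated n k t r -> (forall i, 0 <= x i) -> \sum_i x i ^+ k = 1 ->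
  upset U -> shifted U -> t_intersecting t U -> based m.+1 U ->
  fam_weight k x U = r ->
  exists V : {set {set 'I_n}},
    [/\ upset V, shifted V, t_intersecting t V, based m V &
        forall A : {set 'I_n}, #|A| = k -> weight x A != 0 -> (A \in U) = (A \in V)].
Proof.
move=> t2 tk nk st tm mk dom x0 x1 Uup Ush Ut Ub Ur.
have mn : (m < n)%N by lia.
have k0 : (0 < k)%N by lia.
have m0 : (0 < m)%N by lia.
pose S := segment n m; pose e := Ordinal mn; pose C := critical mn U.
pose q := (m + t - 1)%N.
pose y := flatten_tail k m x.
have cS : #|S| = m by apply: card_segment; exact: ltnW.
have CS Q : Q \in C -> Q \subset S by rewrite inE => /and3P[].
have qk : (q < 2 * k)%N by rewrite /q; lia.
have Ct Q : Q \in C -> (t <= #|Q|)%N by apply: critical_cardT => //; lia.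
have CQ A B : A \in C -> B \in C -> (#|A :&: B| < t)%N ->
    A :|: B = S /\ (#|A| + #|B| = q)%N by exact: critical_card.
(* The competitors keep, without [e], the small ([b = true]) or the large critical sets,
   and those of middle size that avoid [l]. Averaging over [l], with weight 3/5 for
   [b = true] and 2/5 for [b = false], a critical set [Q] is kept with weight
   [K Q / (5 * m)]; by [term] this outweighs the part of its fiber containing [e]. *)
pose sel (b : bool) (l : 'I_n) :=
  [set Q in C | selected k q b #|Q| (l \notin Q)]%SET.
have selC b l : sel b l \subset C by apply/subsetP => Q; rewrite in_set => /andP[].
have sel_t b l : l \in S -> forall A B, A \in sel b l -> B \in sel b l -> (t <= #|A :&: B|)%N.
  move=> lS A B; rewrite in_set => /andP[AC As]; rewrite in_set => /andP[BC Bs].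
  rewrite leqNgt; apply/negP => /(CQ _ _ AC BC) [AB ABq].
  have lAB : (l \in A) || (l \in B) by rewrite -in_setU AB.
  have [] := selected_conflict ABq qk As Bs.
  by move: lAB; case: (l \in A); case: (l \in B).
(* The fibers over members of [U] inside [S] do not shrink under flattening and cancel; only the
   critical traces remain. *)
have sel_le b l : l \in S ->
    \sum_(Q in sel b l) fiber k m y Q <= \sum_(Q in C) fiber_mem k mn x Q.
  move=> lS; have tH := t_intersecting_rebase Ut (selC b l) (sel_t b l lS).
  have := dom _ y tH (flatten_tail_ge0 k m x0).
  rewrite sum_flatten_tail // => /(_ x1).
  rewrite -Ur (fam_weight_critical _ mn _ Uup Ub) fam_weight_fiber //.
  rewrite -lerBrDl; move=> /le_trans; apply.
  rewrite lerBlDl lerD2r; apply: ler_sum => Q /andP[_ QS].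
  exact: fiber_le_flatten.
pose N b (Q : {set 'I_n}) := (\sum_(l in S) selected k q b #|Q| (l \notin Q))%N.
have N_le b : \sum_(Q in C) (N b Q)%:R * fiber k m y Q <=
    m%:R * \sum_(Q in C) fiber_mem k mn x Q.
  have -> (X : R) : m%:R * X = \sum_(l in S) X by rewrite sumr_const cS mulr_natl.
  apply: le_trans (ler_sum _ (fun l lS => sel_le b l lS)).
  rewrite (exchange_big_dep (mem C)) /=; last by move=> l Q _; rewrite in_set => /andP[].
  apply: ler_sum => Q QC; rewrite /N natr_sum mulr_suml big_mkcondr /=.
  apply: ler_sum => l _; rewrite in_set QC /=.
  by case: (selected _ _ _ _ _); rewrite ?mul1r ?mul0r.
have N_const b (Q : {set 'I_n}) c : (forall l, selected k q b #|Q| (l \notin Q) = c) ->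
    N b Q = (c * m)%N.
  by move=> h; rewrite /N (eq_bigr (fun=> c : nat)) ?sum_nat_const ?cS 1?mulnC // => l _;
      rewrite h.
have dE : (t + (k - t) = k)%N by rewrite subnKC // ltnW.
have LE : (t + (n - t) = n)%N by rewrite subnKC //; lia.
have dL : (2 * (k - t) < n - t)%N by lia.
have md : (m < t + 2 * (k - t))%N by lia.
pose K (Q : {set 'I_n}) : R := (3 * N true Q + 2 * N false Q)%:R.
have term Q : Q \in C -> (5 * m)%:R * fiber_mem k mn x Q <= K Q * fiber k m y Q /\
    ((5 * m)%:R * fiber_mem k mn x Q = K Q * fiber k m y Q ->
     ~~ free_size k q #|Q| -> fiber_mem k mn x Q = 0).
  move=> QC; have QS := CS _ QC.
  have [fQ|fQ] := boolP (free_size k q #|Q|).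
    have KE : K Q = (5 * m)%:R.
      by rewrite /K !(N_const _ _ true) => [|l|l]; rewrite /selected ?fQ //; congr _%:R; lia.
    rewrite KE; split => //; rewrite ler_wpM2l //.
    by apply: le_trans (fiber_mem_le _ _ _ x0) (fiber_le_flatten mn k0 x0 QS).
  (* No [k]-set contains both [Q] and [e]. *)
  have [kQ|Qk] := leqP k #|Q|.
    rewrite fiber_mem0 // mulr0; split => //; apply: mulr_ge0 => //.
    exact: fiber_ge0 (flatten_tail_ge0 _ _ x0).
  have lt_case p p' : (0 < p')%N -> contracts k (k - #|Q|) (n - m) p p' ->
      K Q * p'%:R = (5 * m)%:R * p%:R ->
      (5 * m)%:R * fiber_mem k mn x Q <= K Q * fiber k m y Q /\
      ((5 * m)%:R * fiber_mem k mn x Q = K Q * fiber k m y Q -> fiber_mem k mn x Q = 0).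
    move=> p0 con KE; have pR0 : (p'%:R : R) != 0 by rewrite pnatr_eq0 -lt0n.
    have -> : K Q * fiber k m y Q = (5 * m)%:R * (p%:R / p'%:R * fiber k m y Q).
      by rewrite !mulrA -KE mulfK.
    have [h1 h2] := fiber_mem_lt_flatten mn k0 x0 QS Qk p0 con.
    split; first by rewrite ler_wpM2l.
    move=> /mulfI; rewrite pnatr_eq0 muln_eq0 /= -lt0n.
    by move/(_ m0); exact: h2.
  have tQ := Ct _ QC; have aq := fQ; rewrite /free_size -ltnNge in aq.
  have N_side b : (2 * #|Q| != q)%N -> N b Q = (((2 * #|Q| < q)%N == b) * m)%N.
    move=> mid; apply: N_const => l.
    by rewrite /selected (negbTE fQ) Qk (negbTE mid).
  have [mid|mid] := eqVneq (2 * #|Q|)%N q.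
    have NE b : N b Q = (m - #|Q|)%N.
      rewrite -cS -[in RHS](setIidPr QS) -cardsD -sum1_card /N.
      rewrite big_mkcond [RHS]big_mkcond; apply: eq_bigr => l _.
      by rewrite in_setD /selected (negbTE fQ) Qk mid eqxx /=; case: (l \in Q); case: (l \in S).
    have [] := lt_case (m - #|Q|)%N m.
    - exact: m0.
    - have := contracts_middle t2 dL st tm md; rewrite dE LE; apply=> //.
    - by rewrite /K !NE -!natrM; congr _%:R; ring.
    by move=> h1 h2; split => // /h2.
  have [lo|hi] := ltnP (2 * #|Q|)%N q.
    have [] := lt_case 3%N 5%N isT.
    - have := contracts_small t2 dL st tm md; rewrite dE LE; apply=> //.
    - by rewrite /K !N_side // lo /= -!natrM; congr _%:R; ring.
    by move=> h1 h2; split => // /h2.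
  have {}hi : (q < 2 * #|Q|)%N by rewrite ltn_neqAle eq_sym mid.
  have [] := lt_case 2%N 5%N isT.
  - have := contracts_large t2 dL st tm md; rewrite dE LE; apply=> //.
  - by rewrite /K !N_side // ltnNge (ltnW hi) /= -!natrM; congr _%:R; ring.
  by move=> h1 h2; split => // /h2.
have zero Q : Q \in C -> ~~ free_size k q #|Q| -> fiber_mem k mn x Q = 0.
  have d0 P : P \in C -> 0 <= K P * fiber k m y P - (5 * m)%:R * fiber_mem k mn x P.
    by move=> /term[h _]; rewrite subr_ge0.
  have : \sum_(P in C) (K P * fiber k m y P - (5 * m)%:R * fiber_mem k mn x P) = 0.
    apply/eqP; rewrite eq_le sumr_ge0 // andbT sumrB -mulr_sumr subr_le0.
    rewrite (eq_bigr (fun P => 3%:R * ((N true P)%:R * fiber k m y P) + 2%:R * ((N false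
        P)%:R * fiber k m y P))).
      rewrite big_split /= -!mulr_sumr.
      have := N_le true; have := N_le false; rewrite natrM.
      set X := \sum_(_ in _) _; set Y := \sum_(_ in _) _; set Z := \sum_(_ in _) _.
      lra.
    by move=> P _; rewrite /K natrD !natrM; ring.
  move=> /(psumr_eq0P d0) dz QC; have [_ h] := term _ QC; apply: h.
  by apply/esym/eqP; rewrite -subr_eq0 dz.
(* Free sizes are kept without conflict. The choice depends on the size only, as [shifted_rebase]
   requires, unlike that of the competitors. *)
pose W := [set Q in C | free_size k q #|Q|]%SET.
have WC : W \subset C by apply/subsetP => Q; rewrite in_set => /andP[].
have Vt : t_intersecting t (rebase m U W).
  apply: (t_intersecting_rebase Ut WC) => A B.
  rewrite in_set => /andP[AC fA]; rewrite in_set => /andP[BC fB].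
  rewrite leqNgt; apply/negP => /(CQ _ _ AC BC) [_ ABq].
  by have [] := @selected_conflict k q _ _ true false false ABq qk _ _;
    rewrite /selected ?fA ?fB.
exists (rebase m U W); split => //.
- exact: (upset_rebase Uup Ush WC).
- exact: (shifted_rebase Uup Ush (P := free_size k q)).
- exact: based_rebase.
have UV (A : {set 'I_n}) : #|A| = k -> weight x A != 0 -> A \in U -> A \in rebase m U W.
  move=> cA wA AU; rewrite in_set; case AS: (A :&: S \in U) => //=.
  have /andP[eA AC] := @mem_critical _ _ mn U Ub A AU (negbT AS).
  rewrite in_set AC /=; apply: contraT => nf; case/eqP: wA.
  have := zero _ AC nf => /eqP; rewrite psumr_eq0 => [|B _]; last exact: weight_ge0.
  by move=> /allP/(_ A); rewrite mem_index_enum cA !eqxx eA /= => /(_ isT)/eqP.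
by move=> A; apply: (dominated_agree dom).
Qed.

Lemma fam_weight_agree (R : realType) (n k : nat) (x : 'I_n -> R)
    (U V : {set {set 'I_n}}) :
  (forall A : {set 'I_n}, #|A| = k -> weight x A != 0 -> (A \in U) = (A \in V)) ->
  fam_weight k x U = fam_weight k x V.
Proof.
move=> UV; rewrite /fam_weight big_mkcond [RHS]big_mkcond; apply: eq_bigr => A _.
have [cA|] := eqVneq #|A| k; rewrite ?andbF // !andbT.
have [->|wA] := eqVneq (weight x A) 0; first by case: ifP; case: ifP.
by rewrite UV.
Qed.

(** * Shifted families and their generating up-sets *)

Definition index_sum (n : nat) (A : {set 'I_n}) : nat := (\sum_(i in A) i)%N.

Lemma index_sum_shift (n : nat) (i j : 'I_n) (A : {set 'I_n}) :
  (i < j)%N -> j \in A -> i \notin A -> (index_sum (i |: A :\ j)%SET < index_sum A)%N.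
Proof.
move=> ij jA iA; rewrite /index_sum big_setU1 ?inE ?(negbTE iA) ?andbF //=.
by rewrite [X in (_ < X)%N](big_setD1 j) //= ltn_add2r.
Qed.

(** If the common trace is too small, some [j] outside the segment lies in [A :&: B]. As
    [#|A :|: B| <= 2 * k - t], some [i] of the segment is missed by both; shifting [j] to [i] in [A]
    leaves the common trace unchanged and lowers the index sum. *)
Lemma shifted_trace_intersecting (n k t : nat) (F : {set {set 'I_n}}) :
  (t <= k)%N -> (2 * k - t <= n)%N -> uniform k F -> t_intersecting t F ->
  shifted F ->
  forall A B, A \in F -> B \in F -> (t <= #|A :&: B :&: segment n (2 * k - t)|)%N.
Proof.
move=> tk kn /uniformP Fk /t_intersectingP Ft Fsh A B; set S := segment n _.
have [N] := ubnP (index_sum A); elim: N A => // N IHN A AN AF BF.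
rewrite leqNgt; apply/negP => lt.
have [j jAB jS] : exists2 j, j \in A :&: B & j \notin S.
  apply/subsetPn/negP => /setIidPl ABS; move: lt; rewrite ABS ltnNge.
  by rewrite Ft.
have /andP[jA jB] : (j \in A) && (j \in B) by rewrite -in_setI.
have [SAB|/subsetPn[i iS]] := boolP (S \subset A :|: B).
  have : j |: S \subset A :|: B by rewrite subUset SAB sub1set inE jA.
  move=> /subset_leq_card; rewrite cardsU1 jS card_segment //.
  have := Ft _ _ AF BF; have := cardsUI A B; rewrite (Fk _ AF) (Fk _ BF).
  by move: tk; clear; lia.
rewrite inE negb_or => /andP[iA iB].
have ij : (i < j)%N.
  by move: iS jS; rewrite !inE -leqNgt; apply: leq_trans.
have := IHN (i |: A :\ j)%SET _ (Fsh _ _ _ ij jA iA AF) BF.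
rewrite (_ : (i |: A :\ j) :&: B :&: S = A :&: B :&: S)%SET.
  by move=> /(_ (leq_trans (index_sum_shift ij jA iA) AN)); rewrite leqNgt lt.
apply/setP => l; rewrite !in_setI in_setU1 in_setD1.
case: (eqVneq l i) => [->|_] /=; first by rewrite (negbTE iB) !andbF.
by case: (eqVneq l j) => [->|_] //=; rewrite (negbTE jS) !andbF.
Qed.

Lemma shifted_upset (n k t : nat) (F : {set {set 'I_n}}) :
  (t <= k)%N -> (2 * k - t <= n)%N -> uniform k F -> t_intersecting t F ->
  shifted F ->
  exists U : {set {set 'I_n}},
    [/\ upset U, shifted U, t_intersecting t U, based (2 * k - t) U & F \subset U].
Proof.
move=> tk kn Fk Ft Fsh; set S := segment n (2 * k - t).
pose U := [set B : {set 'I_n} | [exists A in F, A :&: S \subset B]]%SET.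
have UP (B : {set 'I_n}) : reflect (exists2 A, A \in F & A :&: S \subset B) (B \in U).
  by rewrite inE; apply: exists_inP.
exists U; split.
- by move=> A B /UP[C CF CA] AB; apply/UP; exists C => //; exact: subset_trans AB.
- move=> i j A ij jA iA /UP[C CF CA]; apply/UP.
  have iCS : i \notin C :&: S by apply: contra iA; apply: (subsetP CA).
  have [jC|jC] := boolP (j \in C :&: S); last first.
    exists C => //; apply/subsetP => l lC; rewrite in_setU1 in_setD1.
    by rewrite (subsetP CA) // andbT; apply/orP; right; apply: contraNneq jC => <-.
  move: jC; rewrite in_setI => /andP[jC jS].
  have iS : i \in S by move: jS; rewrite !inE; apply: ltn_trans.
  have iC : i \notin C by move: iCS; rewrite in_setI iS andbT.
  exists (i |: C :\ j)%SET; first exact: Fsh.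
  apply/subsetP => l; rewrite in_setI !in_setU1 !in_setD1 => /andP[/orP[->//|/andP[-> lC]] lS].
  by rewrite (subsetP CA) ?orbT // in_setI lC.
- apply/t_intersectingP => A B /UP[A' A'F A'A] /UP[B' B'F B'B].
  apply: leq_trans (shifted_trace_intersecting tk kn Fk Ft Fsh A'F B'F) _.
  by apply: subset_leq_card; rewrite setIIl setISS.
- by move=> A /UP[C CF CA]; apply/UP; exists C => //; rewrite subsetI CA subsetIr.
- by apply/subsetP => A AF; apply/UP; exists A => //; rewrite subsetIl.
Qed.

Lemma shifted_segment (n t : nat) (V : {set {set 'I_n}}) (T : {set 'I_n}) :
  (t <= n)%N -> shifted V -> T \in V -> #|T| = t -> segment n t \in V.
Proof.
move=> tn Vsh; have [N] := ubnP (index_sum T); elim: N T => // N IHN T TN TV cT.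
have [ST|/subsetPn[i iS iT]] := boolP (segment n t \subset T).
  have /eqP -> // : segment n t == T by rewrite eqEcard ST cT card_segment ?leqnn.
have [TS|/subsetPn[j jT jS]] := boolP (T \subset segment n t).
  have /eqP <- // : T == segment n t by rewrite eqEcard TS cT card_segment ?leqnn.
have ij : (i < j)%N by move: iS jS; rewrite !inE -leqNgt; apply: leq_trans.
apply: (IHN (i |: T :\ j)%SET); first exact: leq_trans (index_sum_shift ij jT iT) TN.
  exact: Vsh.
by rewrite cardsU1 !inE (negbTE iT) andbF /=; move: cT; rewrite (cardsD1 j) jT.
Qed.

(** A member meeting the first [t + 2] elements in at most [t] has a trace of exactly [t] elements,
    again a member. Shifting it gives the initial segment of size [t], which every member must then
    contain. *)
Lemma based_frankl (n t : nat) (V : {set {set 'I_n}}) :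
  (t + 2 <= n)%N -> shifted V -> t_intersecting t V -> based (t + 2) V ->
  (forall B, B \in V -> segment n t \subset B) \/
  (forall B, B \in V -> (t < #|B :&: segment n (t + 2)|)%N).
Proof.
move=> tn Vsh /t_intersectingP Vt Vb.
have [h|] := boolP [forall B in V, (t < #|B :&: segment n (t + 2)|)%N].
  by right=> B; move/forall_inP: h; apply.
rewrite negb_forall_in => /exists_inP[B BV]; rewrite -leqNgt => Bt; left.
have tn' : (t <= n)%N by apply: leq_trans tn; rewrite leq_addr.
have TV := Vb _ BV; have cT : #|B :&: segment n (t + 2)| = t.
  by apply/eqP; rewrite eqn_leq Bt /=; have := Vt _ _ TV TV; rewrite setIid.
move=> C CV; have SV := shifted_segment tn' Vsh TV cT.
by apply/setIidPl/eqP; rewrite eqEcard subsetIl card_segment // Vt.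
Qed.

Lemma shifted_extremal (R : realType) (n k t : nat) (x : 'I_n -> R) (r : R)
    (F : {set {set 'I_n}}) :
  (2 <= t)%N -> (t < k)%N -> (2 * k - t < n)%N -> star_beats t (k - t) (n - t) ->
  dominated n k t r -> (forall i, 0 <= x i) -> \sum_i x i ^+ k = 1 ->
  uniform k F -> t_intersecting t F -> shifted F -> fam_weight k x F = r ->
  (forall A, A \in F -> weight x A != 0 -> A \in frankl n k t 0) \/
  (forall A, A \in F -> weight x A != 0 -> A \in frankl n k t 1).
Proof.
move=> t2 tk nk st dom x0 x1 Fk Ft Fsh Fr.
have [U [Uup Ush Ut Ub FU]] := shifted_upset (ltnW tk) (ltnW nk) Fk Ft Fsh.
have FUw := dominated_agree dom x0 x1 Fr Ut (fun A _ _ => subsetP FU A).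
have key j : (t + 2 + j <= 2 * k - t)%N -> exists V : {set {set 'I_n}},
    [/\ upset V, shifted V, t_intersecting t V, based (2 * k - t - j) V &
        forall A : {set 'I_n}, #|A| = k -> weight x A != 0 -> (A \in F) = (A \in V)].
  elim: j => [_|j IHj jk]; first by exists U; split => //; rewrite subn0.
  have [|V [Vup Vsh Vt Vb FV]] := IHj; first by move: jk; clear; lia.
  have mE : (2 * k - t - j = (2 * k - t - j.+1).+1)%N by move: jk; clear; lia.
  rewrite mE in Vb.
  have [|||W [Wup Wsh Wt Wb VW]] :=
      descend t2 tk nk st _ _ dom x0 x1 Vup Vsh Vt Vb _.
  - by move: jk; clear; lia.
  - by move: jk; clear; lia.
  - by rewrite -(fam_weight_agree FV).
  by exists W; split => // A cA wA; rewrite FV // VW.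
have [|V [_ Vsh Vt Vb FV]] := key (2 * k - t - (t + 2))%N; first by lia.
have tE : (2 * k - t - (2 * k - t - (t + 2)) = t + 2)%N by lia.
rewrite tE in Vb; have cF A : A \in F -> #|A| = k by move/uniformP: Fk; apply.
have [h|h] := based_frankl (n := n) (t := t) ltac:(lia) Vsh Vt Vb; [left|right] => A AF wA;
  have AV : A \in V by rewrite -FV // cF.
  rewrite inE cF // eqxx /= muln0 !addn0 (setIidPr (h _ AV)) card_segment //.
  lia.
by rewrite inE cF // eqxx /= muln1 addn1 h.
Qed.

(** * Compression *)

Section Compression.
Variables (n : nat) (i j : 'I_n) (F : {set {set 'I_n}}).
Hypothesis ij : (i < j)%N.

Definition movable (A : {set 'I_n}) : bool :=
  [&& j \in A, i \notin A & (i |: A :\ j)%SET \notin F].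

Definition compress_set (A : {set 'I_n}) : {set 'I_n} :=
  if movable A then (i |: A :\ j)%SET else A.

Definition compress : {set {set 'I_n}} := [set compress_set A | A in F]%SET.

Lemma card_compress_set (A : {set 'I_n}) : #|compress_set A| = #|A|.
Proof.
rewrite /compress_set; case: ifP => // /and3P[jA iA _].
by rewrite cardsU1 !inE (negbTE iA) andbF [in RHS](cardsD1 j) jA.
Qed.

Lemma compress_set_inj : {in F &, injective compress_set}.
Proof.
move=> A B AF BF; rewrite /compress_set.
have back (C : {set 'I_n}) : j \in C -> i \notin C -> (j |: (i |: C :\ j) :\ i)%SET = C.
  move=> jC iC; rewrite setU1K ?setD1K //.
  by rewrite !inE (negbTE iC) andbF.
case: ifP => [/and3P[jA iA AF']|_]; case: ifP => [/and3P[jB iB BF']|_] //.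
- by move=> AB; rewrite -(back A) // AB back.
- by move=> AB; rewrite AB BF in AF'.
- by move=> AB; rewrite -AB AF in BF'.
Qed.

Lemma compress_uniform (k : nat) : uniform k F -> uniform k compress.
Proof.
move=> /uniformP Fk; apply/uniformP => _ /imsetP[A AF ->].
by rewrite card_compress_set Fk.
Qed.

Lemma compress_intersecting (t : nat) : t_intersecting t F -> t_intersecting t compress.
Proof.
move=> /t_intersectingP Ft; apply/t_intersectingP => _ _ /imsetP[A AF ->] /imsetP[B BF ->].
have mix (C D : {set 'I_n}) : C \in F -> D \in F -> movable C -> ~~ movable D ->
    (t <= #|(i |: C :\ j) :&: D|)%N.
  move=> CF DF /and3P[jC iC _] mD; have CD := Ft _ _ CF DF.
  have [iD|iD] := boolP (i \in D).
    apply: leq_trans CD _.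
    have [jD|jD] := boolP (j \in D).
      have jCD : j \in C :&: D by rewrite inE jC.
      rewrite [#|C :&: D|](cardsD1 j) jCD (_ : (i |: C :\ j) :&: D = i |: ((C :&: D) :\ j))%SET.
        by rewrite cardsU1 !inE (negbTE iC) andbF.
      apply/setP => l; rewrite !inE; case: (eqVneq l i) => [->|] //=.
      by rewrite andbA.
    apply: subset_leq_card; apply/subsetP => l; rewrite !inE => /andP[lC lD].
    by rewrite lD lC !andbT; apply/orP; right; apply: contraNneq jD => <-.
  have [jD|jD] := boolP (j \in D).
    (* [D] stays in place only because its shift is already in [F]; the shift of [D] meets [C] in a
       subset of the intersection wanted. *)
    have DF' : (i |: D :\ j)%SET \in F.
      by move: mD; rewrite /movable jD iD /= negbK.
    apply: leq_trans (Ft _ _ CF DF') _; apply: subset_leq_card.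
    apply/subsetP => l; rewrite !inE; case: (eqVneq l i) => [->|_] /=.
      by rewrite (negbTE iC).
    by case: (eqVneq l j); rewrite ?andbF //=.
  apply: leq_trans CD _; apply: subset_leq_card; apply/subsetP => l.
  rewrite !inE => /andP[lC lD]; rewrite lD lC !andbT; apply/orP; right.
  by apply: contraNneq jD => <-.
rewrite /compress_set; case mA: (movable A); case mB: (movable B).
- move: mA mB => /and3P[jA iA _] /and3P[jB iB _].
  apply: leq_trans (Ft _ _ AF BF) _.
  have jAB : j \in A :&: B by rewrite inE jA.
  rewrite [#|A :&: B|](cardsD1 j) jAB.
  rewrite (_ : (i |: A :\ j) :&: (i |: B :\ j) = i |: ((A :&: B) :\ j))%SET.
    by rewrite cardsU1 !inE (negbTE iA) andbF.
  apply/setP => l; rewrite !inE; case: (eqVneq l i) => [->|_] //=.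
  by case: (eqVneq l j).
- by apply: mix; rewrite ?mB.
- by rewrite setIC; apply: mix; rewrite ?mA.
- exact: Ft.
Qed.

Lemma index_sum_compress (A : {set 'I_n}) : A \in F -> movable A ->
  (\sum_(B in compress) index_sum B < \sum_(B in F) index_sum B)%N.
Proof.
move=> AF mA; rewrite big_imset; last exact: compress_set_inj.
have le B : (index_sum (compress_set B) <= index_sum B)%N.
  rewrite /compress_set; case: ifP => // /and3P[jB iB _].
  by apply: ltnW; apply: index_sum_shift.
rewrite (bigD1 A) //= [X in (_ < X)%N](bigD1 A) //= -addSn leq_add ?leq_sum //.
by rewrite /compress_set mA; case/and3P: mA => jA iA _; apply: index_sum_shift.
Qed.

Variables (R : realType) (x : 'I_n -> R).
Hypothesis x0 : forall l, 0 <= x l.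

Lemma fam_weight_compress (k : nat) :
  fam_weight k x compress = \sum_(A in F | #|A| == k) weight x (compress_set A).
Proof.
rewrite /fam_weight big_mkcondr big_imset /=; last exact: compress_set_inj.
by rewrite [RHS]big_mkcondr; apply: eq_bigr => A _; rewrite card_compress_set.
Qed.

Lemma weight_movable (A : {set 'I_n}) : movable A ->
  weight x (compress_set A) = x i * weight x (A :\ j) /\
  weight x A = x j * weight x (A :\ j).
Proof.
move=> mA; rewrite /compress_set mA; case/and3P: mA => jA iA _; split.
  by rewrite weightU1 // !inE (negbTE iA) andbF.
by rewrite -weightU1 ?setD1K // !inE eqxx.
Qed.

Lemma weight_le_compress (A : {set 'I_n}) : x j <= x i ->
  weight x A <= weight x (compress_set A).
Proof.
move=> xij; case mA: (movable A); last by rewrite /compress_set mA.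
have [-> ->] := weight_movable mA.
by rewrite ler_wpM2r // weight_ge0.
Qed.

End Compression.

(* Compression terminates because it lowers the sum of all elements. *)
Lemma compression_ind (R : realType) (n k t : nat) (x : 'I_n -> R) (r : R)
    (P : {set {set 'I_n}} -> Prop) :
  dominated n k t r -> (forall l, 0 <= x l) -> \sum_l x l ^+ k = 1 ->
  (forall i j : 'I_n, (i < j)%N -> x j <= x i) ->
  (forall F, uniform k F -> t_intersecting t F -> fam_weight k x F = r ->
     shifted F -> P F) ->
  (forall F (i j : 'I_n), (i < j)%N -> uniform k F -> t_intersecting t F ->
     fam_weight k x F = r -> fam_weight k x (compress i j F) = r ->
     P (compress i j F) -> P F) ->
  forall F, uniform k F -> t_intersecting t F -> fam_weight k x F = r -> P F.
Proof.
move=> dom x0 x1 xdec Psh Pc F.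
have [N] := ubnP (\sum_(B in F) index_sum B)%N; elim: N F => // N IHN F FN Fk Ft Fr.
have [/existsP[i /existsP[j /andP[ij /exists_inP[A AF mA]]]]|no] :=
    boolP [exists i : 'I_n, exists j : 'I_n,
      (i < j)%N && [exists A in F, movable i j F A]]; last first.
  apply: Psh => // i j A ij jA iA AF; apply: contraNT no => nF.
  apply/existsP; exists i; apply/existsP; exists j; rewrite ij /=.
  by apply/exists_inP; exists A => //; apply/and3P.
have Ck := compress_uniform i j Fk; have Ct := compress_intersecting i j Ft.
have Cr : fam_weight k x (compress i j F) = r.
  apply/eqP; rewrite eq_le dom //= -Fr fam_weight_compress.
  by apply: ler_sum => B _; apply: weight_le_compress => //; exact: xdec.
apply: (Pc F i j) => //; apply: IHN => //.
exact: leq_trans (index_sum_compress ij AF mA) FN.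
Qed.

(** * The full star *)

Section Star.
Variables (R : realType) (n k t : nat).
Hypotheses (t0 : (0 < t)%N) (tk : (t < k)%N) (kn : (k < n)%N).

Let d := (k - t)%N.
Let L := (n - t)%N.
Let S := segment n t.
Let a : R := k%:R^-1 `^ k%:R^-1.
Let b : R := (d%:R / (k * L)%:R) `^ k%:R^-1.

(* The Lagrange point of the full star: the mass of [x i ^+ k] is [1/k] on each
   kernel element, and is spread evenly over the other elements. *)
Definition star_point (i : 'I_n) : R := if (i < t)%N then a else b.

Let k0 : (0 < k)%N. Proof. by lia. Qed.
Let d0 : (0 < d)%N. Proof. by rewrite /d; lia. Qed.
Let dL : (d < L)%N. Proof. by rewrite /d /L; lia. Qed.
Let tn : (t <= n)%N. Proof. by lia. Qed.
Let kR0 : (0 : R) < k%:R. Proof. by rewrite ltr0n. Qed.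
Let LR0 : (0 : R) < L%:R. Proof. by rewrite ltr0n; lia. Qed.
Let dR0 : (0 : R) < d%:R. Proof. by rewrite ltr0n. Qed.

Let rootK (u : R) : 0 <= u -> (u `^ k%:R^-1) ^+ k = u.
Proof.
move=> u0; rewrite -powR_mulrn ?powR_ge0 // -powRrM mulVf ?gt_eqF // powRr1 //.
Qed.

Let aE : a ^+ k = k%:R^-1. Proof. by rewrite rootK // invr_ge0 ltW. Qed.
Let bE : b ^+ k = d%:R / (k * L)%:R. Proof. by rewrite rootK // divr_ge0. Qed.
Let a0 : 0 < a. Proof. by rewrite powR_gt0 // invr_gt0. Qed.
Let b0 : 0 < b. Proof. by rewrite powR_gt0 // divr_gt0 // natrM mulr_gt0. Qed.

Let ba : b < a.
Proof.
rewrite -(@ltr_pXn2r _ k) // ?nnegrE ?ltW // aE bE natrM.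
by rewrite ltr_pdivrMr ?mulr_gt0 // mulrA mulVf ?gt_eqF // mul1r ltr_nat.
Qed.

Lemma star_point_gt0 (i : 'I_n) : 0 < star_point i.
Proof. by rewrite /star_point; case: ifP. Qed.

Lemma star_point_lt (i j : 'I_n) :
  (i < t)%N -> (t <= j)%N -> star_point j < star_point i.
Proof. by move=> it tj; rewrite /star_point it ltnNge tj. Qed.

Lemma star_point_pow (i : 'I_n) :
  star_point i ^+ k = if (i < t)%N then k%:R^-1 else d%:R / (k * L)%:R.
Proof. by rewrite /star_point; case: ifP. Qed.

Lemma sum_star_point : \sum_i star_point i ^+ k = 1.
Proof.
rewrite (bigID (mem S)) /= (eq_bigr (fun=> k%:R^-1)) => [|i]; last first.
  by rewrite inE star_point_pow => ->.
rewrite sumr_const [X in _ + X](eq_bigr (fun=> d%:R / (k * L)%:R)) => [|i]; last first.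
  by rewrite inE star_point_pow => /negbTE ->.
have -> : \sum_(i | i \notin S) (d%:R / (k * L)%:R) = \sum_(i in ~: S) (d%:R / (k * L)%:R) :> R.
  by apply: eq_bigl => i; rewrite in_setC.
rewrite sumr_const card_setC_segment // card_segment // -/L.
have -> : k%:R^-1 *+ t = t%:R / k%:R :> R by rewrite -[LHS]mulr_natl.
have -> : (d%:R / (k * L)%:R) *+ L = d%:R / k%:R :> R.
  by rewrite -[LHS]mulr_natl natrM; field; rewrite !gt_eqF.
by rewrite -mulrDl -natrD subnKC ?divff ?gt_eqF // ltnW.
Qed.

Lemma mem_star (A : {set 'I_n}) :
  (A \in frankl n k t 0) = (#|A| == k) && (S \subset A).
Proof.
rewrite inE muln0 !addn0; case: eqP => //= _; apply/idP/idP => [h|/setIidPr ->].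
  by apply/setIidPr/eqP; rewrite eqEcard subsetIr card_segment.
by rewrite card_segment.
Qed.

Lemma weight_star_point (A : {set 'I_n}) :
  A \in frankl n k t 0 -> weight star_point A = a ^+ t * b ^+ d.
Proof.
rewrite mem_star => /andP[/eqP cA SA].
rewrite -(setID A S) weightU; last first.
  rewrite -setI_eq0; apply/eqP/setP => i; rewrite !in_setI in_setD in_set0.
  by case: (i \in S); rewrite ?andbF.
have -> : A :&: S = S by apply/setIidPr.
have cD : #|A :\: S| = d by rewrite cardsD (setIidPr SA) card_segment // cA.
rewrite (eq_weight (y := fun=> a)) => [|i]; last by rewrite inE /star_point => ->.
rewrite [X in _ * X](eq_weight (y := fun=> b)) => [|i]; last first.
  by rewrite !inE /star_point => /andP[/negbTE ->].
by rewrite /weight !prodr_const cD card_segment.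
Qed.

Let count_star (P : pred {set 'I_n}) :
  #|[set A in frankl n k t 0 | P (A :\: S)]%SET| =
  #|[set D : {set 'I_n} | [&& D \subset ~: S, #|D| == d & P D]]%SET|.
Proof.
have cS : #|S| = t by exact: card_segment.
(* With all weights equal to 1, the fiber formula is an identity between cardinalities. *)
have := @sum_fiber R _ (fun=> 1) S S k P (subxx _); rewrite cS => /(_ (ltnW tk)).
have w1 (A : {set 'I_n}) : weight (fun=> 1 : R) A = 1 by rewrite /weight big1.
under eq_bigr do rewrite w1; under [X in _ = _ * X]eq_bigr do rewrite w1.
rewrite w1 mul1r !sumr_const => /eqP; rewrite eqr_nat => /eqP h.
transitivity #|[pred A : {set 'I_n} | [&& #|A| == k, A :&: S == S & P (A :\: S)]]|.
  apply: eq_card => A; rewrite in_set mem_star -andbA; congr [&& _, _ & _].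
  by apply/idP/eqP => /setIidPr.
by apply: etrans h _; apply: eq_card => D; rewrite in_set.
Qed.

Lemma card_star : #|frankl n k t 0| = 'C(L, d).
Proof.
rewrite /L -(card_setC_segment tn) -cards_draws -/S.
have := count_star xpredT; rewrite (eq_card (B := mem (frankl n k t 0))) => [->|A].
  by apply: eq_card => D; rewrite !inE andbT.
by rewrite !inE andbT.
Qed.

Lemma deg_star (i : 'I_n) : (t <= i)%N ->
  #|[set A in frankl n k t 0 | i \in A]%SET| = 'C(L.-1, d.-1).
Proof.
move=> ti; have iS : i \in ~: S by rewrite !inE -leqNgt.
have := count_star (fun D => i \in D).
rewrite (eq_card (B := mem [set A in frankl n k t 0 | i \in A]%SET)) => [->|A]; last first.
  by rewrite !inE ltnNge ti.
rewrite -sum1_card (eq_bigl (fun D : {set 'I_n} =>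
    [&& D \subset ~: S, #|D| == d.-1.+1 & i \in D])).
  rewrite (sum_draws_mem d.-1 (fun=> 1%N) iS) sum1_card.
  rewrite /L -(card_setC_segment tn) -/S [#|~: S|](cardsD1 i) iS -cards_draws.
  by apply: eq_card => D; rewrite !inE.
by move=> D; rewrite inE prednK.
Qed.

Let v := star_point.
Let om := a ^+ t * b ^+ d.
Let om_gt0 : 0 < om. Proof. by rewrite mulr_gt0 // exprn_gt0. Qed.

Lemma fam_weight_star (z : 'I_n -> R) :
  fam_weight k z (frankl n k t 0) = \sum_(A in frankl n k t 0) weight z A.
Proof.
rewrite /fam_weight; apply: eq_bigl => A; rewrite mem_star.
by case: (#|A| == k); rewrite ?andbT ?andbF.
Qed.

Lemma fam_weight_star_point :
  fam_weight k star_point (frankl n k t 0) = 'C(L, d)%:R * om.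
Proof.
rewrite fam_weight_star (eq_bigr _ weight_star_point) sumr_const card_star.
by rewrite -[LHS]mulr_natl.
Qed.

(** These are the Lagrange equations: the degree divided by [v i ^+ k] is the same inside and
    outside the kernel, by [L * 'C(L.-1, d.-1) = d * 'C(L, d)]. The bound given by the certificate
    is then constant on the sphere. *)
Lemma deg_star_point (z : 'I_n -> R) : \sum_i z i ^+ k = 1 ->
  \sum_i (\sum_(A in frankl n k t 0 | i \in A) weight v A) * (z i / v i) ^+ k =
  k%:R * ('C(L, d)%:R * om).
Proof.
move=> z1; rewrite -[RHS]mulr1 -[X in _ = _ * X]z1 mulr_sumr; apply: eq_bigr => i _.
rewrite (eq_bigr (fun=> om)); last by move=> A /andP[/weight_star_point].
rewrite sumr_const -[om *+ _]mulr_natl expr_div_n star_point_pow.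
case: ltnP => [it|ti].
  rewrite (_ : #|_| = 'C(L, d)) ?invrK; first by ring.
  rewrite -card_star; apply: eq_card => A; rewrite unfold_in /=.
  case AF: (A \in frankl n k t 0) => //=; move: AF; rewrite mem_star => /andP[_ /subsetP].
  by apply; rewrite inE.
have bin : (L%:R * 'C(L.-1, d.-1)%:R = d%:R * 'C(L, d)%:R :> R).
  rewrite -!natrM; congr _%:R; rewrite mul_bin_diag !prednK //.
rewrite (_ : #|_| = 'C(L.-1, d.-1)); last first.
  by rewrite -(deg_star ti); apply: eq_card => A; rewrite in_set.
rewrite natrM; apply: (@mulfI _ d%:R); first by rewrite gt_eqF.
rewrite [RHS](_ : _ = (d%:R * 'C(L, d)%:R) * (k%:R * om * z i ^+ k)); last by ring.
by rewrite -bin; field; rewrite !gt_eqF.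
Qed.

Lemma fam_weight_star_le (z : 'I_n -> R) :
  (forall i, 0 <= z i) -> \sum_i z i ^+ k = 1 ->
  fam_weight k z (frankl n k t 0) <= fam_weight k star_point (frankl n k t 0).
Proof.
move=> z0 z1; rewrite fam_weight_star_point fam_weight_star -(ler_pM2l kR0).
apply: le_trans (sum_weight_le_deg k0 (leqnn k) _ star_point_gt0 z0) _.
  by move=> A; rewrite mem_star => /andP[/eqP].
by rewrite subnn mul0r addr0 deg_star_point.
Qed.

(** Equality holds in AM-GM for every set of the star, so [z i / v i] is constant on each of them.
    They share a kernel element and cover the ground set, so the ratio is constant, and it is 1 by
    normalization. *)
Lemma star_point_unique (z : 'I_n -> R) :
  (forall i, 0 <= z i) -> \sum_i z i ^+ k = 1 ->
  fam_weight k star_point (frankl n k t 0) <= fam_weight k z (frankl n k t 0) ->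
  z =1 star_point.
Proof.
move=> z0 z1; rewrite fam_weight_star_point fam_weight_star => zge.
pose u i := (z i / v i) ^+ k.
have v0 i : 0 < v i by exact: star_point_gt0.
have zv0 i : 0 <= z i / v i by rewrite divr_ge0 // ltW.
have u0 i : 0 <= u i by rewrite exprn_ge0.
have cA A : A \in frankl n k t 0 -> #|A| = k by rewrite mem_star => /andP[/eqP].
have wzE A : A \in frankl n k t 0 -> weight z A = om * weight (fun i => z i / v i) A.
  move=> AF; rewrite /om -(weight_star_point AF) /weight -big_split /=.
  by apply: eq_bigr => i _; rewrite mulrC divfK // gt_eqF.
pose gap (A : {set 'I_n}) := om * ((\sum_(i in A) u i) / k%:R) - weight z A.
have gap0 A : A \in frankl n k t 0 -> 0 <= gap A.
  move=> AF; rewrite /gap wzE // -mulrBr pmulr_rge0 // subr_ge0.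
  have := prod_le_mean_pow (A := A) (k := k) zv0 k0.
  by rewrite cA // subnn addr0; apply.
have sgap : \sum_(A in frankl n k t 0) gap A = 0.
  apply/eqP; rewrite eq_le sumr_ge0 // andbT sumrB subr_le0.
  apply: le_trans zge; rewrite -(ler_pM2l kR0) -(deg_star_point z1) mulr_sumr.
  rewrite (eq_bigr (fun A : {set 'I_n} => \sum_(i | i \in A) weight v A * u i)) => [|A AF].
    rewrite (exchange_big_dep xpredT) //=.
    by apply: ler_sum => i _; rewrite mulr_suml.
  by rewrite -mulr_sumr (weight_star_point AF) -/om mulrCA [k%:R * _]mulrC divfK ?gt_eqF.
have uA A i j : A \in frankl n k t 0 -> i \in A -> j \in A -> u i = u j.
  move=> AF iA jA; have := psumr_eq0P gap0 sgap AF.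
  move=> /eqP; rewrite /gap wzE // -mulrBr mulf_eq0 (gt_eqF om_gt0) subr_eq0 /= => /eqP mE.
  have [_] := @leif_AGM R _ (mem A) u (fun i _ => u0 i).
  rewrite -[#|mem A|]/#|A| cA // mE prodrXl eqxx =>
      /esym/forall_inP/(_ i iA)/forall_inP/(_ j jA).
  by move/eqP.
pose i0 := Ordinal (leq_trans t0 tn).
have ui i : u i = u i0.
  have i0S A : A \in frankl n k t 0 -> i0 \in A.
    by rewrite mem_star => /andP[_ /subsetP]; apply; rewrite inE.
  have [A AF iA] : exists2 A, A \in frankl n k t 0 & i \in A.
    have [it|ti] := ltnP i t.
      have : (0 < #|frankl n k t 0|)%N by rewrite card_star bin_gt0 ltnW.
      case/card_gt0P=> A AF; exists A => //; move: AF; rewrite mem_star.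
      by move=> /andP[_ /subsetP]; apply; rewrite inE.
    have : (0 < #|[set A in frankl n k t 0 | i \in A]%SET|)%N.
      by rewrite deg_star // bin_gt0 -ltnS !prednK //; [exact: ltnW|exact: leq_ltn_trans dL].
    by case/card_gt0P=> A; rewrite inE => /andP[AF iA]; exists A.
  by apply: (uA A) => //; exact: i0S.
have zE i : z i ^+ k = u i0 * v i ^+ k.
  by rewrite -(ui i) /u expr_div_n divfK // expf_neq0 // gt_eqF.
have ui0 : u i0 = 1.
  move: z1; rewrite (eq_bigr _ (fun i _ => zE i)) -mulr_sumr sum_star_point.
  by rewrite mulr1.
move=> i; apply/eqP; rewrite -(@eqrXn2 _ k) ?zE ?ui0 ?mul1r ?eqxx // ltW //.
Qed.

Hypothesis nk : (2 * k - t < n)%N.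

(** The two families differ by their traces on the first [t + 2] elements: the star alone has the
    trace [S], and [A_1] alone has the [t] traces [S2 :\ i] with [i] in [S]. Their fibers at the
    star point are explicit, and the comparison reduces to [key]. *)
Lemma star_beats_of_le :
  fam_weight k star_point (frankl n k t 1) <= fam_weight k star_point (frankl n k t 0) ->
  star_beats t d L.
Proof.
move=> le; have t2n : (t + 2 <= n)%N by lia.
pose S2 := segment n (t + 2).
have cS2 : #|S2| = (t + 2)%N by exact: card_segment.
have SS2 : S \subset S2 by apply/subsetP => i; rewrite !inE => /leq_trans; apply;
    rewrite leq_addr.
have mem1 (A : {set 'I_n}) : (A \in frankl n k t 1) = (#|A| == k) && (t < #|A :&: S2|)%N.
  by rewrite inE muln1 addn1.
have w0 (A : {set 'I_n}) : 0 <= weight star_point A by apply: weight_ge0 => i;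
    exact/ltW/star_point_gt0.
pose F0 := fiber k (t + 2) star_point S.
pose F1 i := fiber k (t + 2) star_point (S2 :\ i).
have cmp : \sum_(i in S) F1 i <= F0.
  have sub1 (i : 'I_n) : i \in S -> #|S2 :\ i| = t.+1.
    by move=> iS; have := cardsD1 i S2; rewrite (subsetP SS2 _ iS) cS2 addn2 => -[].
  have F1le : \sum_(i in S) F1 i <=
      \sum_(A in frankl n k t 1 | A \notin frankl n k t 0) weight star_point A.
    rewrite (exchange_big_dep (fun A =>
        (A \in frankl n k t 1) && (A \notin frankl n k t 0))) /=.
      apply: ler_sum => A _; have [i /andP[iS /andP[cA iA]]|no] :=
          pickP (fun i => (i \in S) && ((#|A| == k) && (A :&: S2 == S2 :\ i)));
              last by rewrite big_pred0.
      rewrite (bigD1 i) ?iS ?cA ?iA //= big1 ?addr0 // => j.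
      move=> /andP[/andP[jS jA] /negP[]]; apply/eqP; apply: contraTeq jA => ji.
      rewrite (eqP iA); apply/eqP => /setP/(_ j); rewrite !in_setD1 eqxx ji.
      by rewrite (subsetP SS2 _ jS).
    move=> i A iS /andP[cA /eqP iA]; rewrite mem1 cA iA sub1 // ltnS leqnn /=.
    rewrite mem_star cA /=; apply: contraTN isT => /subsetP/(_ _ iS) iAA.
    by have := setD11 i S2; rewrite -iA inE iAA (subsetP SS2 _ iS).
  apply: le_trans F1le _.
  have F0ge : \sum_(A in frankl n k t 0 | A \notin frankl n k t 1) weight star_point A <= F0.
    rewrite /F0 /fiber big_mkcond [X in _ <= X]big_mkcond; apply: ler_sum => A _.
    case: ifP => [/andP[]|_]; last by case: ifP.
    rewrite mem_star mem1 => /andP[-> SA]; rewrite /= -leqNgt => At.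
    suff -> : A :&: S2 == S by [].
    by rewrite eq_sym eqEcard subsetI SA SS2 card_segment.
  apply: le_trans F0ge; move: le; rewrite !fam_weight_star /fam_weight.
  rewrite (eq_bigl (fun A => A \in frankl n k t 1)) => [|A]; last first.
    by rewrite mem1; case: (#|A| == k); rewrite ?andbT ?andbF.
  rewrite (bigID (fun A => A \in frankl n k t 0)) /=.
  rewrite [X in _ <= X](bigID (fun A => A \in frankl n k t 1)) /=.
  rewrite [X in X + _ <= _](eq_bigl (fun A =>
      (A \in frankl n k t 0) && (A \in frankl n k t 1))).
    by rewrite lerD2l.
  by move=> A; rewrite andbC.
pose B : R := 'C(L - 2, d.-1)%:R.
have esumE l : esum star_point (~: S2) l = 'C(L - 2, l)%:R * b ^+ l.
  rewrite (esum_const (b := b)) ?card_setC_segment //; last first.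
    move=> i; rewrite !inE /star_point -leqNgt => h; rewrite ltnNge.
    by rewrite (leq_trans _ h) // leq_addr.
  by rewrite subnDA.
have cS : #|S| = t by exact: card_segment.
have F0E : F0 = a ^+ t * ('C(L - 2, d)%:R * b ^+ d).
  rewrite /F0 fiberE // cS ?(ltnW tk) // esumE; congr (_ * _).
  rewrite (eq_weight (y := fun=> a)) => [|i]; last by rewrite inE /star_point => ->.
  by rewrite /weight prodr_const cS.
have F1E i : i \in S -> F1 i = a ^+ t.-1 * b ^+ 2 * (B * b ^+ d.-1).
  move=> iS; have iS2 : i \in S2 by exact: (subsetP SS2).
  have cQ : #|S2 :\ i| = t.+1 by have := cardsD1 i S2; rewrite iS2 cS2 addn2 => -[].
  have dE : (k - t.+1 = d.-1)%N by rewrite subnS.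
  rewrite /F1 fiberE ?cQ ?subD1set // esumE dE -/B; congr (_ * _).
  rewrite -(setID (S2 :\ i) S) weightU; last first.
    by rewrite -setI_eq0; apply/eqP/setP => l; rewrite !inE; case: (l < t)%N; rewrite ?andbF.
  have SiE : (S2 :\ i) :&: S = S :\ i by rewrite setIDAC (setIidPr SS2).
  rewrite SiE.
  have cSi : #|S :\ i| = t.-1 by have := cardsD1 i S; rewrite iS cS => ->.
  have cD : #|(S2 :\ i) :\: S| = 2.
    rewrite cardsD SiE cQ cSi.
    by move: t0; clear; lia.
  rewrite (eq_weight (y := fun=> a)) => [|l]; last by rewrite !inE /star_point => /andP[_ ->].
  rewrite [X in _ * X](eq_weight (y := fun=> b)) => [|l]; last first.
    by rewrite !inE /star_point => /andP[/negbTE ->].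
  by rewrite /weight !prodr_const cSi cD.
have B0 : 0 < B by rewrite ltr0n bin_gt0; move: nk tk; rewrite /L /d; clear; lia.
have key : t%:R * d%:R * b <= (L - d.+1)%:R * a.
  move: cmp; rewrite (eq_bigr _ F1E) sumr_const cS F0E => h.
  have ab0 : 0 < a ^+ t.-1 * b ^+ d * B by rewrite !mulr_gt0 ?exprn_gt0.
  rewrite -(ler_pM2l ab0).
  have binE : d%:R * 'C(L - 2, d)%:R = (L - d.+1)%:R * B.
    rewrite -!natrM; congr _%:R; have := mul_bin_left (L - 2) d.-1.
    by rewrite prednK // => ->; congr (_ * _)%N; move: d0 dL; clear; lia.
  have aS : a ^+ t = a ^+ t.-1 * a by rewrite -exprSr prednK.
  have bS : b ^+ d = b ^+ d.-1 * b by rewrite -exprSr prednK.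
  rewrite [X in _ <= X](_ : _ = d%:R * (a ^+ t * ('C(L - 2, d)%:R * b ^+ d))); last first.
    rewrite aS [X in _ = X](_ : _ = a ^+ t.-1 * a * b ^+ d * (d%:R * 'C(L - 2, d)%:R));
        last by ring.
    by rewrite binE; ring.
  rewrite [X in X <= _](_ : _ = d%:R * ((a ^+ t.-1 * b ^+ 2 * (B * b ^+ d.-1)) *+ t));
      last first.
    by rewrite -[X in d%:R * X]mulr_natl bS; ring.
  by rewrite ler_pM2l.
have : (t%:R * d%:R * b) ^+ k <= ((L - d.+1)%:R * a) ^+ k.
  by apply: lerXn2r => //; rewrite nnegrE ?mulr_ge0 // ltW.
rewrite !exprMn aE bE natrM [X in X <= _](_ : _ = (t%:R ^+ k * d%:R ^+ k * d%:R) / (k%:R *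
    L%:R)); last by ring.
rewrite ler_pdivrMr ?mulr_gt0 // mulrA divfK ?gt_eqF // -!natrX -!natrM ler_nat.
have tdk : (t + d = k)%N by rewrite subnKC // ltnW.
by rewrite /star_beats tdk expnSr mulnA.
Qed.

End Star.

(** * Extremal families *)

Lemma spectral_radius_fam (R : realType) (n k : nat) (F : {set {set 'I_n}}) :
  (0 < n)%N -> (0 < k)%N -> uniform k F ->
  (exists z : 'I_n -> R, [/\ forall i, 0 <= z i, \sum_i z i ^+ k = 1 &
     k%:R * fam_weight k z F = spectral_radius R k F]) /\
  (forall z : 'I_n -> R, (forall i, 0 <= z i) -> \sum_i z i ^+ k = 1 ->
     k%:R * fam_weight k z F <= spectral_radius R k F).
Proof.
move=> n0 k0 /uniformP Fk; have [[x [x0 x1] xr] ub] := spectral_radius_max R F n0 k0.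
have formE y : family_form k F y = k%:R * fam_weight k (fun i => y 0 i : R) F.
  congr (_ * _); apply: eq_bigl => A; case AF: (A \in F) => //=.
  by rewrite Fk ?eqxx.
split; first by exists (fun i => x 0 i); split; rewrite // -formE.
move=> z z0 z1; pose y : 'rV[R]_n := \row_i z i.
have yz i : y 0 i = z i by rewrite mxE.
have := ub y; rewrite formE /fam_weight.
under eq_bigr do rewrite (eq_weight (y := z)) //; apply; split => [i|].
  by rewrite yz.
by rewrite -z1; apply: eq_bigr => i _; rewrite yz.
Qed.

Lemma dominated_spectral (R : realType) (n k t : nat) (r : R) :
  (0 < n)%N -> (0 < k)%N ->
  (forall G : {set {set 'I_n}}, uniform k G -> t_intersecting t G ->
     spectral_radius R k G <= k%:R * r) ->
  dominated n k t r.
Proof.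
move=> n0 k0 h H y /t_intersectingP Ht y0 y1.
pose G := [set A in H | #|A| == k]%SET.
have Gk : uniform k G by apply/uniformP => A; rewrite inE => /andP[_ /eqP].
have Gt : t_intersecting t G.
  by apply/t_intersectingP => A B; rewrite !inE => /andP[AH _] /andP[BH _]; apply: Ht.
have [_ /(_ y y0 y1) le] := spectral_radius_fam R n0 k0 Gk.
have kR0 : (0 : R) < k%:R by rewrite ltr0n.
rewrite -(ler_pM2l kR0); apply: le_trans (h _ Gk Gt); apply: le_trans le.
rewrite ler_pM2l // le_eqVlt; apply/orP; left; apply/eqP.
by apply: eq_bigl => A; rewrite inE -andbA andbb.
Qed.

Lemma frankl_uniform (n k t r : nat) : uniform k (frankl n k t r).
Proof. by apply/uniformP => A; rewrite inE => /andP[/eqP]. Qed.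

Lemma frankl_intersecting (n k t r : nat) : (t + 2 * r <= n)%N ->
  t_intersecting t (frankl n k t r).
Proof.
move=> rn; apply/t_intersectingP => A B.
rewrite !inE => /andP[_ AS] /andP[_ BS]; set S := segment _ _ in AS BS.
apply: (@leq_trans #|(A :&: S) :&: (B :&: S)|); last first.
  by apply: subset_leq_card; rewrite setISS // subsetIl.
have := cardsUI (A :&: S) (B :&: S).
have : (#|(A :&: S) :|: (B :&: S)| <= t + 2 * r)%N.
  by rewrite -(card_segment rn) subset_leq_card // subUset !subsetIr.
by move: AS BS; clear; lia.
Qed.

Lemma exists_antitone_perm (R : realType) (n : nat) (z : 'I_n -> R) :
  exists s : {perm 'I_n}, forall i j : 'I_n, (i < j)%N -> z (s j) <= z (s i).
Proof.
pose ge : rel 'I_n := fun i j => z j <= z i.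
have ge_total : total ge by move=> i j; exact: le_total.
have ge_trans : transitive ge by move=> j i l ij jl; exact: le_trans ij.
have /tuple_permP[s sE] : perm_eq (sort_tuple ge (ord_tuple n)) (ord_tuple n).
  by rewrite perm_sort.
exists s => i j ij.
have nthE (l : 'I_n) : nth i (sort ge (ord_tuple n)) l = s l.
  have -> : sort ge (ord_tuple n) = [tuple tnth (ord_tuple n) (s l) | l < n] :> seq _ by [].
  by rewrite -tnth_nth tnth_mktuple tnth_ord_tuple.
have := sorted_ltn_nth ge_trans i (sort_sorted ge_total (ord_tuple n)).
move=> /(_ i j); rewrite !inE size_sort size_tuple !ltn_ord => /(_ isT isT ij).
by rewrite !nthE.
Qed.

Section PermFamily.
Variables (n : nat) (s : {perm 'I_n}) (F : {set {set 'I_n}}).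

Lemma imset_perm_inj : injective (fun A : {set 'I_n} => s @: A)%SET.
Proof. exact/imset_inj/perm_inj. Qed.

Lemma perm_family_uniform (k : nat) : uniform k F -> uniform k (perm_family s F).
Proof.
move=> /uniformP Fk; apply/uniformP => _ /imsetP[A AF ->].
by rewrite card_imset ?Fk //; exact: perm_inj.
Qed.

Lemma perm_family_intersecting (t : nat) :
  t_intersecting t F -> t_intersecting t (perm_family s F).
Proof.
move=> /t_intersectingP Ft; apply/t_intersectingP => _ _ /imsetP[A AF ->] /imsetP[B BF ->].
rewrite -imsetI; last by move=> i j _ _; exact: perm_inj.
by rewrite card_imset ?Ft //; exact: perm_inj.
Qed.

Lemma fam_weight_perm (R : realType) (k : nat) (z : 'I_n -> R) :
  fam_weight k z (perm_family s F) = fam_weight k (z \o s) F.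
Proof.
rewrite /fam_weight big_mkcondr big_imset /=; last by move=> A B _ _; exact: imset_perm_inj.
rewrite [RHS]big_mkcondr; apply: eq_bigr => A _.
rewrite card_imset; last exact: perm_inj.
by case: ifP => // _; rewrite /weight big_imset //= => i j _ _; exact: perm_inj.
Qed.

Lemma perm_familyK : perm_family s (perm_family s^-1 F) = F.
Proof.
rewrite /perm_family -imset_comp -[RHS]imset_id; apply: eq_imset => A /=.
by rewrite -imset_comp -[RHS]imset_id; apply: eq_imset => i /=; rewrite permKV.
Qed.

End PermFamily.

Lemma exists_draw (T : finType) (B : {set T}) (l : nat) :
  (l <= #|B|)%N -> exists2 D : {set T}, D \subset B & #|D| = l.
Proof.
rewrite -bin_gt0 -cards_draws => /card_gt0P[D]; rewrite inE => /andP[DB /eqP cD].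
by exists D.
Qed.

(** The sets of a permuted star share a point [p], whereas [t + 1] of the first [t + 2] elements can
    be chosen without [p] and completed to a member of [A_1] that avoids [p]. *)
Lemma frankl1_not_star (n k t : nat) : (0 < t)%N -> (t < k)%N -> (k < n)%N ->
  (t + 2 <= n)%N -> ~ equal_up_to_perm (frankl n k t 1) (frankl n k t 0).
Proof.
move=> t0 tk kn tn [s sE]; pose p := s (Ordinal (ltn_trans t0 (ltn_trans tk kn))).
pose S2 := segment n (t + 2).
have [Q QS cQ] : exists2 Q : {set 'I_n}, Q \subset S2 :\ p & #|Q| = t.+1.
  apply: exists_draw; have := cardsD1 p S2; rewrite card_segment //.
  by case: (p \in S2); lia.
have QS2 : Q \subset S2 by apply: subset_trans QS (subD1set _ _).
have pQ : p \notin Q by apply/negP => /(subsetP QS); rewrite setD11.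
have [D DQ cD] : exists2 D : {set 'I_n}, D \subset ~: (p |: Q) & #|D| = (k - t.+1)%N.
  apply: exists_draw; rewrite cardsCs setCK card_ord cardsU1 pQ cQ.
  by clear p QS cQ QS2 pQ sE; lia.
have QD : Q :&: D = finset.set0.
  apply/setP => i; rewrite !inE; case iQ: (i \in Q) => //=.
  by apply/negP => /(subsetP DQ); rewrite !inE iQ orbT.
have cA : #|Q :|: D| = k by rewrite cardsU QD cards0 subn0 cQ cD subnKC.
have : Q :|: D \in frankl n k t 1.
  rewrite inE cA eqxx muln1 addn1 -cQ subset_leq_card //.
  by rewrite subsetI subsetUl.
rewrite sE => /imsetP[A]; rewrite mem_star ?(ltnW (ltn_trans tk kn)) // =>
    /andP[_ /subsetP SA] QDA.
have : p \in Q :|: D by rewrite QDA; apply: imset_f; apply: SA; rewrite inE.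
by rewrite inE (negbTE pQ) /= => /(subsetP DQ); rewrite !inE eqxx.
Qed.

Lemma fam_weight_subset_eq (R : realType) (n k : nat) (z : 'I_n -> R)
    (F G : {set {set 'I_n}}) :
  (forall i, 0 < z i) -> uniform k G -> F \subset G ->
  fam_weight k z G <= fam_weight k z F -> F = G.
Proof.
move=> z0 /uniformP Gk /subsetP FG le; apply/setP => A; apply/idP/idP; first exact: FG.
move=> AG; apply: contraT => AF; move: le; rewrite leNgt => /negP[].
rewrite /fam_weight [X in _ < X](bigD1 A) ?AG ?Gk ?eqxx //=.
rewrite ltr_pwDl ?prodr_gt0 //.
rewrite [X in X <= _]big_mkcond [X in _ <= X]big_mkcond; apply: ler_sum => B _.
case: ifP => [/andP[BF cB]|_]; last by case: ifP => // _; apply: weight_ge0 => i; exact: ltW.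
by rewrite FG // cB /=; case: eqP BF AF => [->|] // ->.
Qed.

Lemma fam_weight_le_support (R : realType) (n k : nat) (z : 'I_n -> R)
    (F G : {set {set 'I_n}}) :
  (forall i, 0 <= z i) -> (forall A, A \in F -> weight z A != 0 -> A \in G) ->
  fam_weight k z F <= fam_weight k z G.
Proof.
move=> z0 FG; rewrite /fam_weight big_mkcond [X in _ <= X]big_mkcond.
apply: ler_sum => A _; case: ifP => [/andP[AF cA]|_].
  have [->|wA] := eqVneq (weight z A) 0; first by case: ifP.
  by rewrite (FG _ AF wA) cA.
by case: ifP => // _; exact: weight_ge0.
Qed.

Section Main.
Variables (R : realType) (n k t : nat).
Hypotheses (t2 : (2 <= t)%N) (tk : (t < k)%N) (nk : (2 * k - t < n)%N).

Let A0 : {set {set 'I_n}} := frankl n k t 0.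
Let A1 : {set {set 'I_n}} := frankl n k t 1.
Let rho0 : R := spectral_radius R k A0.
Let rho1 : R := spectral_radius R k A1.

Let t0 : (0 < t)%N. Proof. exact: ltnW. Qed.
Let k0 : (0 < k)%N. Proof. exact: ltn_trans tk. Qed.
Let kn : (k < n)%N. Proof. by move: tk nk; clear; lia. Qed.
Let n0 : (0 < n)%N. Proof. exact: ltn_trans kn. Qed.
Let tn : (t + 2 <= n)%N. Proof. by move: tk nk; clear; lia. Qed.
Let kR0 : (0 : R) < k%:R. Proof. by rewrite ltr0n. Qed.
Let A0k : uniform k A0 := frankl_uniform n k t 0.
Let A1k : uniform k A1 := frankl_uniform n k t 1.
Let A0t : t_intersecting t A0.
Proof. by apply: frankl_intersecting; move: tn; clear; lia. Qed.
Let A1t : t_intersecting t A1. Proof. exact: frankl_intersecting. Qed.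

Let star : 'I_n -> R := star_point R k t.
Let star_gt0 i : 0 < star i := star_point_gt0 R t0 tk kn i.
Let star_ge0 i : 0 <= star i. Proof. exact: ltW. Qed.
Let star_sum : \sum_i star i ^+ k = 1 := sum_star_point R t0 tk kn.

Lemma spectral_radius_star : rho0 = k%:R * fam_weight k star A0.
Proof.
have [[z [z0 z1 zr]] ub] := spectral_radius_fam R n0 k0 A0k.
apply/eqP; rewrite eq_le ub // andbT /rho0 -zr ler_pM2l //.
exact: fam_weight_star_le.
Qed.

Hypothesis rho10 : rho1 <= rho0.

Lemma star_beats_of_spectral : star_beats t (k - t) (n - t).
Proof.
apply: (@star_beats_of_le R) => //; rewrite -(ler_pM2l kR0).
rewrite -[X in _ <= X]spectral_radius_star; apply: le_trans rho10.
by have [_] := spectral_radius_fam R n0 k0 A1k; apply.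
Qed.

Lemma antitone_reorder (z : 'I_n -> R) (F : {set {set 'I_n}}) :
  (forall i, 0 <= z i) -> \sum_i z i ^+ k = 1 -> uniform k F -> t_intersecting t F ->
  exists (s : {perm 'I_n}) (y : 'I_n -> R),
    [/\ forall i, 0 <= y i, \sum_i y i ^+ k = 1,
        forall i j : 'I_n, (i < j)%N -> y j <= y i &
        [/\ uniform k (perm_family s F), t_intersecting t (perm_family s F) &
        fam_weight k y (perm_family s F) = fam_weight k z F]].
Proof.
move=> z0 z1 Fk Ft; have [s sz] := exists_antitone_perm z.
exists (s^-1)%g, (z \o s); split => //=.
  by rewrite -z1 [RHS](reindex_inj (@perm_inj _ s)).
split; [exact: perm_family_uniform|exact: perm_family_intersecting|].
rewrite fam_weight_perm; congr (fam_weight _ _ _); apply/funext => i /=.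
by rewrite permKV.
Qed.

(** Domination requires a global optimum, so [G] is first replaced by one of the finitely many
    families with the largest spectral radius. *)
Lemma spectral_radius_le_star (G : {set {set 'I_n}}) :
  uniform k G -> t_intersecting t G -> spectral_radius R k G <= rho0.
Proof.
move=> Gk Gt; pose P (F : {set {set 'I_n}}) := uniform k F && t_intersecting t F.
have PG : P G by rewrite /P Gk.
case: (@arg_maxP _ _ _ G P (fun F => spectral_radius R k F) PG) => F /andP[Fk Ft] Fmax.
apply: (le_trans (Fmax _ PG)).
have [[z [z0 z1 zr]] _] := spectral_radius_fam R n0 k0 Fk.
have dom : dominated n k t (fam_weight k z F).
  by apply: dominated_spectral => // H Hk Ht; rewrite zr; apply: Fmax; rewrite /P Hk.
have [s [y [y0 y1 ydec [sFk sFt yr]]]] := antitone_reorder z0 z1 Fk Ft.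
rewrite -zr; apply: (compression_ind (P := fun=> k%:R * fam_weight k z F <= rho0)
  dom y0 y1 ydec _ _ sFk sFt yr) => // H Hk Ht Hr Hsh.
have := shifted_extremal t2 tk nk star_beats_of_spectral dom y0 y1 Hk Ht Hsh Hr.
have [_ ub0] := spectral_radius_fam R n0 k0 A0k.
have [_ ub1] := spectral_radius_fam R n0 k0 A1k.
rewrite -Hr => -[h|h].
  apply: le_trans (ub0 y y0 y1); rewrite ler_pM2l //.
  exact: fam_weight_le_support.
apply: le_trans rho10; apply: le_trans (ub1 y y0 y1); rewrite ler_pM2l //.
exact: fam_weight_le_support.
Qed.

Lemma extremal_unique (F : {set {set 'I_n}}) : rho1 < rho0 ->
  spectrally_extremal R k t F -> equal_up_to_perm F A0.
Proof.
move=> lt10 [Fk Ft Fmax].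
have Fr : spectral_radius R k F = rho0.
  by apply/eqP; rewrite eq_le spectral_radius_le_star //= Fmax.
have [[z [z0 z1 zr]] _] := spectral_radius_fam R n0 k0 Fk.
have rE : fam_weight k z F = fam_weight k star A0.
  apply: (@mulfI _ k%:R); first by rewrite gt_eqF.
  by rewrite zr Fr spectral_radius_star.
have dom : dominated n k t (fam_weight k z F).
  apply: dominated_spectral => // H Hk Ht; rewrite zr Fr.
  exact: spectral_radius_le_star.
have [s [y [y0 y1 ydec [sFk sFt yr]]]] := antitone_reorder z0 z1 Fk Ft.
suff sF : perm_family s F = A0.
  by exists (s^-1)%g; rewrite -sF -[X in perm_family _ (perm_family X _)]invgK perm_familyK.
have y_star : fam_weight k star A0 <= fam_weight k y A0 -> y =1 star.
  exact: star_point_unique.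
(* Optimality of [H] inside the star forces [y] to be the star point; its positivity leaves no room
   for a proper subfamily. *)
have conclude H : uniform k H -> H \subset A0 -> fam_weight k y H = fam_weight k z F -> H = A0.
  move=> Hk HA Hr; have HAw : fam_weight k y H <= fam_weight k y A0.
    by apply: fam_weight_le_support => // A /(subsetP HA).
  have yS : y =1 star by apply: y_star; rewrite -rE -Hr.
  apply: (fam_weight_subset_eq (z := y) _ A0k HA) => [i|]; first by rewrite yS.
  rewrite Hr rE (_ : y = star) //; exact/funext.
apply: (compression_ind (P := fun H => H = A0) dom y0 y1 ydec _ _ sFk sFt yr).
  move=> H Hk Ht Hr Hsh.
  have [h|h] := shifted_extremal t2 tk nk star_beats_of_spectral dom y0 y1 Hk Ht Hsh Hr.
    have yS : y =1 star.
      by apply: y_star; rewrite -rE -Hr; apply: fam_weight_le_support.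
    apply: conclude => //; apply/subsetP => A /h; apply.
    by rewrite gt_eqF // prodr_gt0 // => i _; rewrite yS.
  have [_ /(_ y y0 y1) ub1] := spectral_radius_fam R n0 k0 A1k.
  move: lt10; rewrite ltNge => /negP[]; apply: le_trans ub1.
  rewrite spectral_radius_star -rE -Hr ler_pM2l //.
  exact: fam_weight_le_support.
move=> H i j ij Hk Ht Hr Cr CA.
have yS : y =1 star by apply: y_star; rewrite -rE -Cr CA.
have y_gt0 l : 0 < y l by rewrite yS.
apply: conclude => //; apply/subsetP => A AH.
have CAA : compress_set i j H A \in A0 by rewrite -CA; apply: imset_f.
have [mA|mA] := boolP (movable i j H A); last first.
  by move: CAA; rewrite /compress_set (negbTE mA).
(* If [y j < y i], moving [A] would increase the weight strictly, but compression kept it equal to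
   the maximum. *)
have yij : y i <= y j.
  rewrite leNgt; apply/negP => ltij; move: Cr; rewrite -Hr fam_weight_compress //.
  apply/eqP; rewrite gt_eqF // /fam_weight.
  have cA : #|A| == k by apply/eqP; move/uniformP: Hk; apply.
  rewrite (bigD1 A) ?AH ?cA //= [X in _ < X](bigD1 A) ?AH ?cA //=.
  apply: ltr_leD; last first.
    by apply: ler_sum => B _; apply: weight_le_compress => //; exact: ydec.
  have [-> ->] := weight_movable y mA.
  by rewrite ltr_pM2r ?prodr_gt0.
move: CAA; rewrite /compress_set mA; case/and3P: (mA) => jA iA _.
rewrite !mem_star ?(ltnW (ltn_trans tk kn)) // => /andP[/eqP cA /subsetP SA].
(* The moved set contains the kernel but not [j], so [j] is outside the kernel; then [yij] puts [i]
   outside it too, and [A] already contained the kernel. *)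
have jt : (t <= j)%N.
  rewrite leqNgt; apply/negP => jt; have := SA j; rewrite inE => /(_ jt).
  by rewrite !inE eqxx orbF => /eqP ji; move: ij; rewrite ji ltnn.
have it : (t <= i)%N.
  rewrite leqNgt; apply/negP => it.
  by move: yij; rewrite !yS leNgt star_point_lt.
apply/andP; split; first by apply/eqP; move/uniformP: Hk; apply.
apply/subsetP => l lS; have := SA l lS; rewrite !inE => /orP[/eqP li|/andP[]//].
by move: lS; rewrite li inE ltnNge it.
Qed.

End Main.

Theorem theorem1p1 (R : realType) (n k t : nat) (ht : (2 <= t)%N)
    (htk : (t < k)%N) (hn : (2 * k - t < n)%N) :
  let A0 : {set {set 'I_n}} := frankl n k t 0 in
  let A1 : {set {set 'I_n}} := frankl n k t 1 in
  let rho0 : R := spectral_radius R k A0 in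
  let rho1 : R := spectral_radius R k A1 in
  [/\ spectrally_extremal R k t A0 <-> rho1 <= rho0,
      rho1 < rho0 ->
        spectrally_extremal R k t A0 /\
        (forall F : {set {set 'I_n}}, spectrally_extremal R k t F ->
           equal_up_to_perm F A0) &
      rho0 = rho1 ->
        [/\ spectrally_extremal R k t A0,
            spectrally_extremal R k t A1 &
            ~ (forall F : {set {set 'I_n}}, spectrally_extremal R k t F ->
                 equal_up_to_perm F A0)] ].
Proof.
move=> A0 A1 rho0 rho1.
have A0k : uniform k A0 by exact: frankl_uniform.
have A1k : uniform k A1 by exact: frankl_uniform.
have A0t : t_intersecting t A0 by apply: frankl_intersecting; lia.
have A1t : t_intersecting t A1 by apply: frankl_intersecting; lia.
have ext0 : rho1 <= rho0 -> spectrally_extremal R k t A0.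
  by move=> le10; split => // G Gk Gt; exact: spectral_radius_le_star.
split; first by split => // -[_ _]; apply.
- move=> lt10; split; first exact/ext0/ltW.
  by move=> F; apply: extremal_unique => //; exact: ltW.
move=> eq01; have le10 : rho1 <= rho0 by rewrite eq01.
have ext1 : spectrally_extremal R k t A1.
  by split => // G Gk Gt; rewrite -/rho1 -eq01; exact: spectral_radius_le_star.
split => //; first exact: ext0.
by move=> /(_ _ ext1); apply: frankl1_not_star; lia.
Qed.
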